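(* Consider the Hopfield neural network $$\dot x=-\Lambda x+Tg(x)+I(t)=:F_{\mathrm H}(x),\qquad x\in\mathbb{R}^n,$$ where $\Lambda\in\mathbb{R}^{n\times n}$ is diagonal and positive definite, $T\in\mathbb{R}^{n\times n}$ is an irreducible (entrywise) non-negative matrix, $I:\mathbb{R}_{\ge0}\to\mathbb{R}^n_{\ge0}$ is a time-varying input, and $g(x)=(g_1(x_1),\dots,g_n(x_n))^{\top}$ where each $g_i:\mathbb{R}\to\mathbb{R}$ is Lipschitz continuous, monotonic non-decreasing, satisfies $g_i(0)=0$, and has the finite sector property $0\le\frac{g_i(x)-g_i(y)}{x-y}\le\overline{G}_i$ for all $x\neq y$, with $\overline{G}=(\overline{G}_1,\dots,\overline{G}_n)^{\top}\in\mathbb{R}^n_{>0}$. Assume the Metzler matrix $-\Lambda+T[\overline{G}]$ is Hurwitz with left and right Perron eigenpairs $(-c,v)$ and $(-c,w)$, respectively. For any $p\in[1,\infty]$, define $q\in[1,\infty]$ by $\frac1p+\frac1q=1$ (with the convention $1/\infty=0$) and $\eta\in\mathbb{R}^n_{>0}$ by $$\eta=\Big(v_1^{1/p}/w_1^{1/q},\dots,v_n^{1/p}/w_n^{1/q}\Big)^{\top}.$$ Then for any $p\in[1,\infty]$: (i) the Hopfield neural network is monotone and contracting with respect to the norm $\|\cdot\|_{p,[\eta]}$ with rate $c$; (ii) if $I(t)=I^*$ is constant, then the Hopfield neural network has a unique globally exponentially stable equilibrium point $x_I^*$ with the Lyapunov functions $\|x-x_I^*\|_{p,[\eta]}$ and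 $\|F_{\mathrm H}(x)\|_{p,[\eta]}$; (iii) if $t\mapsto x_I(t)$ and $t\mapsto x_J(t)$ are solutions of the Hopfield neural network for input signals $t\mapsto I(t)$ and $t\mapsto J(t)$ respectively, then for every $t\in\mathbb{R}_{\ge0}$, $$\|x_I(t)-x_J(t)\|_{p,[\eta]}\le e^{-ct}\|x_I(0)-x_J(0)\|_{p,[\eta]}+\int_0^t e^{-c(t-s)}\|I(s)-J(s)\|_{p,[\eta]}\,ds.$$
   Context: For a vector $\eta$, $[\eta]$ is the diagonal matrix with diagonal $\eta$; $\|x\|_{p,R}=\|Rx\|_p$. A matrix is Metzler if its off-diagonal entries are non-negative, and Hurwitz if all its eigenvalues have negative real part. For an irreducible Metzler matrix, the Perron eigenvalue is the (real, simple) eigenvalue of maximal real part, and left/right Perron eigenvectors are corresponding entrywise positive left/right eigenvectors. Inequalities between vectors are entrywise. Let $\phi(t,t_0,x_0)$ denote the flow of a system $\dot x=f(t,x)$. The system is monotone (on $\mathbb{R}^n$) if $x_0\le y_0$ implies $\phi(t,t_0,x_0)\le\phi(t,t_0,y_0)$ for all $t\ge t_0$. It is contracting with rate $c>0$ with respect to a norm $\|\cdot\|$ if $\|\phi(t,t_0,x)-\phi(t,t_0,y)\|\le e^{-c(t-t_0)}\|x-y\|$ for all $x,y\in\mathbb{R}^n$ and all $0\le t_0\le t$. *)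

(* Defs.v *)
From mathcomp Require Import all_boot all_order all_algebra.
From mathcomp Require Import complex polydiv.
From mathcomp Require Import all_classical all_reals all_analysis.

Set Implicit Arguments.
Unset Strict Implicit.
Unset Printing Implicit Defensive.

Import Order.TTheory GRing.Theory Num.Theory.
Import numFieldNormedType.Exports.

Local Open Scope classical_set_scope.
Local Open Scope ring_scope.

(* Vectors of R^n are column matrices, with entries [x i 0]. *)

Definition diagv (R : realType) (n : nat) (eta : 'cV[R]_n) : 'M[R]_n :=
  diag_mx eta^T.

Definition vle (R : realType) (n : nat) (x y : 'cV[R]_n) : Prop :=
  forall i, x i 0 <= y i 0.

(* Only used for 1 <= p; the value at p = -oo is junk. *)
Definition pnorm (R : realType) (n : nat) (p : \bar R) (x : 'cV[R]_n) : R :=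
  match p with
  | p%:E => (\sum_(i < n) `|x i 0| `^ p) `^ p^-1
  | +oo%E => \big[Num.max/0]_(i < n) `|x i 0|
  | -oo%E => 0
  end.

Definition wnorm (R : realType) (n : nat) (p : \bar R) (A : 'M[R]_n)
  (x : 'cV[R]_n) : R := pnorm p (A *m x).

Definition posdef (R : realType) (n : nat) (A : 'M[R]_n) : Prop :=
  forall x : 'cV[R]_n, x != 0 -> 0 < (x^T *m A *m x) 0 0.

(* No simultaneous permutation of rows and columns makes [A] block triangular
   with two nonempty diagonal blocks. Every 1 x 1 matrix is irreducible. *)
Definition irreducible_mx (R : realType) (n : nat) (A : 'M[R]_n) : Prop :=
  forall S : {set 'I_n}, S != finset.set0 -> S != [set: 'I_n]%SET ->
    exists i j, [/\ i \in S, j \notin S & A i j != 0].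

Definition complexify (R : realType) (n : nat) (A : 'M[R]_n) : 'M[R[i]]_n :=
  map_mx (real_complex R) A.

Definition hurwitz (R : realType) (n : nat) (A : 'M[R]_n) : Prop :=
  forall z : R[i], eigenvalue (complexify A) z -> complex.Re z < 0.

(* [eigenvalue] refers to row eigenvectors; left and right eigenvectors give
   the same spectrum. *)
Definition perron_eigenvalue (R : realType) (n : nat) (A : 'M[R]_n) (l : R)
  : Prop :=
  [/\ eigenvalue A l,
      mup l (char_poly A) = 1%N &
      forall z : R[i], eigenvalue (complexify A) z -> complex.Re z <= l].

Definition left_perron_pair (R : realType) (n : nat) (A : 'M[R]_n)
  (l : R) (v : 'cV[R]_n) : Prop :=
  [/\ perron_eigenvalue A l, forall i, 0 < v i 0 & v^T *m A = l *: v^T].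

Definition right_perron_pair (R : realType) (n : nat) (A : 'M[R]_n)
  (l : R) (w : 'cV[R]_n) : Prop :=
  [/\ perron_eigenvalue A l, forall i, 0 < w i 0 & A *m w = l *: w].

Definition loc_integrable (R : realType) (n : nat) (u : R -> 'cV[R]_n)
  : Prop :=
  forall t, 0 <= t -> forall i,
    (@lebesgue_measure R).-integrable `[0, t] (EFin \o (fun s => u s i 0)).

(* Caratheodory solution of x' = f(t, x) on [t0, +oo[. When s |-> f s (x s) is
   continuous, this is the same as being a C^1 solution. *)
Definition solution (R : realType) (n : nat) (f : R -> 'cV[R]_n -> 'cV[R]_n)
  (t0 : R) (x : R -> 'cV[R]_n) : Prop :=
  forall t, t0 <= t -> forall i,
    (@lebesgue_measure R).-integrable `[t0, t]
      (EFin \o (fun s => f s (x s) i 0)) /\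
    x t i 0 = x t0 i 0 + \int[@lebesgue_measure R]_(s in `[t0, t]) f s (x s) i 0.

Definition is_flow (R : realType) (n : nat) (f : R -> 'cV[R]_n -> 'cV[R]_n)
  (phi : R -> R -> 'cV[R]_n -> 'cV[R]_n) : Prop :=
  forall t0 x0, 0 <= t0 ->
    [/\ phi t0 t0 x0 = x0,
        solution f t0 (fun t => phi t t0 x0) &
        forall x, solution f t0 x -> x t0 = x0 ->
          forall t, t0 <= t -> x t = phi t t0 x0].

(* [f] has a globally defined (hence unique) flow, and this flow is monotone. *)
Definition monotone_system (R : realType) (n : nat)
  (f : R -> 'cV[R]_n -> 'cV[R]_n) : Prop :=
  exists2 phi, is_flow f phi &
    forall t0 t x0 y0, 0 <= t0 -> t0 <= t ->
      vle x0 y0 -> vle (phi t t0 x0) (phi t t0 y0).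

Definition contracting_system (R : realType) (n : nat)
  (f : R -> 'cV[R]_n -> 'cV[R]_n) (nrm : 'cV[R]_n -> R) (c : R) : Prop :=
  0 < c /\
  exists2 phi, is_flow f phi &
    forall t0 t x y, 0 <= t0 -> t0 <= t ->
      nrm (phi t t0 x - phi t t0 y) <= expR (- c * (t - t0)) * nrm (x - y).

Definition hopfield (R : realType) (n : nat) (Lam T : 'M[R]_n)
  (g : 'I_n -> R -> R) (u x : 'cV[R]_n) : 'cV[R]_n :=
  - Lam *m x + T *m (\col_i g i (x i 0)) + u.

(* Here [`|_|] is the sup norm of 'cV[R]_n. *)
Definition globally_exp_stable (R : realType) (n : nat)
  (F : 'cV[R]_n -> 'cV[R]_n) (xs : 'cV[R]_n) : Prop :=
  exists K k : R, [/\ 0 < K, 0 < k &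
    forall t0 x, 0 <= t0 -> solution (fun=> F) t0 x ->
      forall t, t0 <= t ->
        `|x t - xs| <= K * expR (- k * (t - t0)) * `|x t0 - xs|].

(* Global Lyapunov function for exponential stability. [V] need not be
   differentiable, so its decay is expressed along trajectories; it entails
   strict decrease along every trajectory as long as it has not reached [xs]. *)
Definition lyapunov_function (R : realType) (n : nat)
  (F : 'cV[R]_n -> 'cV[R]_n) (xs : 'cV[R]_n) (V : 'cV[R]_n -> R) : Prop :=
  [/\ continuous V,
      V xs = 0,
      forall x, x != xs -> 0 < V x,
      forall M : R, exists r : R, forall x, r < `|x| -> M < V x &
      exists2 k : R, 0 < k &
        forall t0 x, 0 <= t0 -> solution (fun=> F) t0 x ->
          forall s t, t0 <= s -> s <= t ->
            V (x t) <= expR (- k * (t - s)) * V (x s)].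

(* Main.v *)
From HB Require Import structures.
Require Import Defs.
From mathcomp Require Import all_boot all_order all_algebra.
From mathcomp Require Import complex lra ring.
From mathcomp Require Import all_classical all_reals all_analysis.
From mathcomp Require Import measurable_realfun.

Set Implicit Arguments.
Unset Strict Implicit.
Unset Printing Implicit Defensive.

Import Order.TTheory GRing.Theory Num.Theory.
Import numFieldNormedType.Exports.

Local Open Scope classical_set_scope.
Local Open Scope ring_scope.

(** For m large, the field is H(x) - m x + I(t) with
    H(x) = (m - Lambda) x + T g(x) order preserving and
    |H(x) - H(y)| <= B |x - y| entrywise, where B = m - Lambda + T [G] is
    non-negative. The Perron vectors satisfy v^T B = (m - c) v^T and
    B w = (m - c) w, so by the Schur test (Young's inequality with weights
    v_i w_i) B, and hence H, has Lipschitz constant m - c in the weighted p-norm.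
    Writing solutions by variation of constants with the factor e^(-m t) and
    applying Gronwall gives the estimate (iii), contraction and uniqueness; the
    same argument applied to the sum of the v_i (x_i - y_i)^+ gives monotonicity.
    Solutions exist by Picard iteration. The equilibrium is the Banach fixed point
    of x |-> (H(x) + I) / m in the norm max |x_i| / w_i, and the norm of the field
    decays because contraction applies to a trajectory and its small time shifts. *)

(** * The weighted p-norms and the Schur test *)

(** Inputs are merely integrable, so trajectories are only absolutely continuous and every estimate
    is an inequality between integrals rather than between derivatives. In that form Gronwall's
    argument needs a non-negative constant and cannot by itself produce decay. This is why the
    damping [m] stays in the kernel e^(-m(t-s)) while the Lipschitz constant k = m - c enters as
    growth: the net rate k - m = -c does not depend on the choice of [m]. The exponent [p] is
    inspected only to obtain norming functionals, definiteness, measurability and the Schur test;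
    everything after that treats all p, endpoints included, alike. *)

Lemma young_powR (R : realType) (p x y : R) : 1 <= p -> 0 <= x -> 0 <= y ->
  x * y `^ (p - 1) <= x `^ p / p + (1 - p^-1) * y `^ p.
Proof.
move=> p1 x0 y0; have p0 : 0 < p by exact: lt_le_trans p1.
(* For [p = 1] the conjugate exponent is infinite; both sides then equal [x], since a power with
   exponent 0 is 1 even at [y = 0]. *)
move: p1; rewrite le_eqVlt => /predU1P[<-|p1].
  by rewrite invr1 !subrr powRr0 mul0r addr0 powRr1// divr1 mulr1.
have q0 : 0 < 1 - p^-1 by rewrite subr_gt0 invf_lt1.
have := @conjugate_powR R x (y `^ (p - 1)) p (1 - p^-1)^-1 x0 (powR_ge0 _ _) p0.
rewrite invr_gt0 invrK => /(_ q0); rewrite addrC subrK => /(_ erefl).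
rewrite -powRrM [(p - 1) / _](_ : _ = p); first by rewrite [_ * (1 - _)]mulrC.
by field; rewrite !lt0r_neq0 ?subr_gt0.
Qed.

Lemma pnormE (R : realType) (n : nat) (p : R) (x : 'cV[R]_n) : 1 <= p ->
  pnorm p%:E x `^ p = \sum_(i < n) `|x i 0| `^ p.
Proof.
move=> p1; rewrite /pnorm -powRrM mulVf ?powRr1//.
  by apply: sumr_ge0 => i _; exact: powR_ge0.
by rewrite gt_eqF// (lt_le_trans _ p1).
Qed.

Lemma pnorm_ge0 (R : realType) (n : nat) (p : \bar R) (x : 'cV[R]_n) :
  0 <= pnorm p x.
Proof.
case: p => [p| |] //=; first exact: powR_ge0.
by apply: bigmax_ge_id.
Qed.

Lemma sum_powR_div_pnorm (R : realType) (n : nat) (p : R) (x : 'cV[R]_n) :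
  1 <= p -> 0 < pnorm p%:E x ->
  \sum_(i < n) (`|x i 0| / pnorm p%:E x) `^ p = 1.
Proof.
move=> p1 N0.
under eq_bigr do rewrite powRM ?invr_ge0 ?pnorm_ge0//.
rewrite -mulr_suml -pnormE// -powRM ?invr_ge0 ?pnorm_ge0//.
by rewrite divff ?powR1// gt_eqF.
Qed.

Lemma pnorm_eq0 (R : realType) (n : nat) (p : \bar R) (x : 'cV[R]_n) :
  (1 <= p)%E -> pnorm p x = 0 -> x = 0.
Proof.
move=> p1 x0; apply/colP => i; rewrite [RHS]mxE; apply/eqP; rewrite -normr_eq0.
case: p p1 x0 => [p| |] //=; rewrite ?lee_fin => p1.
  move=> /powR_eq0_eq0/eqP.
  rewrite psumr_eq0; last by move=> *; exact: powR_ge0.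
  by move=> /allP/(_ i); rewrite mem_index_enum => /(_ isT)/eqP/powR_eq0_eq0 ->.
move=> x0; rewrite eq_le normr_ge0 andbT -{}x0.
exact: (le_bigmax 0 (fun i => `|x i 0|)).
Qed.

(* The functional is sg(x_i) (|x_i| / ||x||)^(p-1) for finite p, and the signed
   coordinate of a maximal entry for p = +oo. *)
Lemma pnorm_dual (R : realType) (n : nat) (p : \bar R) (x : 'cV[R]_n) :
  (1 <= p)%E -> exists xi : 'I_n -> R,
    \sum_i xi i * x i 0 = pnorm p x /\
    forall z : 'cV[R]_n, \sum_i `|xi i| * `|z i 0| <= pnorm p z.
Proof.
move=> p1; have := pnorm_ge0 p x; rewrite le_eqVlt => /predU1P[x0|x0].
  exists (fun=> 0); split=> [|z]; last first.
    by rewrite big1 ?pnorm_ge0// => i _; rewrite normr0 mul0r.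
  by rewrite -x0 big1// => i _; rewrite mul0r.
case: p p1 x0 => [p| |] //; rewrite ?lee_fin => p1 x0.
  have p0 : 0 < p by exact: lt_le_trans p1.
  have := sum_powR_div_pnorm p1 x0; have := ltW x0.
  move: (pnorm p%:E x) x0 => N x0 N0 sx.
  exists (fun i => Num.sg (x i 0) * (`|x i 0| / N) `^ (p - 1)); split=> [|z].
    transitivity (N * \sum_(i < n) (`|x i 0| / N) `^ p); last first.
      by rewrite sx mulr1.
    rewrite mulr_sumr; apply: eq_bigr => i _.
    rewrite mulrAC -normrEsg -[in RHS](@mulr_powRB1 _ _ p)//; last first.
      by rewrite divr_ge0.
    by rewrite mulrA [N * _]mulrC divfK// gt_eqF.
  apply: (@le_trans _ _ (\sum_i `|z i 0| * (`|x i 0| / N) `^ (p - 1))).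
    apply: ler_sum => i _; rewrite mulrC ler_wpM2l// normrM.
    rewrite [X in _ * X]ger0_norm ?powR_ge0// ler_piMl ?powR_ge0//.
    by rewrite normr_sg lern1 leq_b1.
  have := pnorm_ge0 p%:E z; rewrite le_eqVlt => /predU1P[z0|z0].
    rewrite -z0 big1// => i _.
    by rewrite (pnorm_eq0 _ (esym z0)) ?lee_fin// mxE normr0 mul0r.
  have := sum_powR_div_pnorm p1 z0; have := ltW z0.
  move: (pnorm p%:E z) z0 => Z z0 Z0 sz.
  rewrite -[leRHS]mulr1 -ler_pdivrMl// mulrC mulr_suml.
  apply: (@le_trans _ _ (\sum_i ((`|z i 0| / Z) `^ p / p
                         + (1 - p^-1) * (`|x i 0| / N) `^ p))).
    apply: ler_sum => i _; rewrite mulrAC.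
    by apply: young_powR; rewrite // divr_ge0.
  rewrite big_split/= -mulr_suml -mulr_sumr sx sz.
  by rewrite mul1r mulr1 addrC subrK.
case: n x x0 => [|n] x x0; first by rewrite /pnorm big_ord0 ltxx in x0.
have [//|i0 _ xi0] := @eq_bigmax _ _ _ 0 ord0 xpredT (fun i => `|x i 0|) erefl.
exists (fun i => (i == i0)%:R * Num.sg (x i 0)); split=> [|z].
  rewrite /pnorm xi0 (bigD1 i0)//= eqxx mul1r -normrEsg big1 ?addr0//.
  by move=> i /negPf ->; rewrite !mul0r.
rewrite (bigD1 i0)//= eqxx mul1r big1 ?addr0; last first.
  by move=> i /negPf ->; rewrite mul0r normr0 mul0r.
apply: (@le_trans _ _ `|z i0 0|).
  by rewrite ler_piMl// normr_sg lern1 leq_b1.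
exact: (le_bigmax 0 (fun i => `|z i 0|)).
Qed.

(* Every vector has a norming functional whose entrywise absolute value is
   dominated by [N] on absolute values; this single property yields the norm
   axioms, monotonicity in [|x|] and Minkowski's integral inequality. *)
Definition dual_norm (R : realType) (n : nat) (N : 'cV[R]_n -> R) : Prop :=
  forall x : 'cV[R]_n, exists xi : 'I_n -> R, \sum_i xi i * x i 0 = N x /\
    forall z : 'cV[R]_n, \sum_i `|xi i| * `|z i 0| <= N z.

Lemma diagv_mulE (R : realType) (n : nat) (eta x : 'cV[R]_n) i :
  (diagv eta *m x) i 0 = eta i 0 * x i 0.
Proof. by rewrite /diagv mul_diag_mx !mxE. Qed.

Lemma dual_norm_wnorm (R : realType) (n : nat) (p : \bar R) (eta : 'cV[R]_n) :
  (1 <= p)%E -> dual_norm (wnorm p (diagv eta)).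
Proof.
move=> p1 x; have [xi [xix xiz]] := pnorm_dual (diagv eta *m x) p1.
exists (fun i => xi i * eta i 0); split=> [|z].
  by rewrite /wnorm -xix; apply: eq_bigr => i _; rewrite diagv_mulE mulrA.
apply: le_trans (xiz (diagv eta *m z)); apply: ler_sum => i _.
by rewrite diagv_mulE !normrM mulrA.
Qed.

Lemma wnorm_eq0 (R : realType) (n : nat) (p : \bar R) (eta x : 'cV[R]_n) :
  (1 <= p)%E -> (forall i, eta i 0 != 0) -> wnorm p (diagv eta) x = 0 -> x = 0.
Proof.
move=> p1 eta0 /(pnorm_eq0 p1)/colP ex; apply/colP => i.
by move: (ex i); rewrite diagv_mulE !mxE => /eqP; rewrite mulf_eq0 (negPf (eta0 _)) => /eqP.
Qed.

Section DualNorm.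
Context (R : realType) (n : nat) (N : 'cV[R]_n -> R).
Implicit Types x y : 'cV[R]_n.
Hypothesis dualN : dual_norm N.

Lemma dual_norm_ge0 x : 0 <= N x.
Proof.
have [xi [_ /(_ x)]] := dualN x; apply: le_trans.
by apply: sumr_ge0 => i _; exact: mulr_ge0.
Qed.

Lemma dual_norm_le x y : (forall i, `|x i 0| <= `|y i 0|) -> N x <= N y.
Proof.
move=> xy; have [xi [<- /(_ y)]] := dualN x; apply: le_trans.
apply: ler_sum => i _; apply: le_trans (ler_norm _) _.
by rewrite normrM ler_wpM2l.
Qed.

Lemma dual_norm0 : N 0 = 0.
Proof.
by have [xi [<- _]] := dualN 0; rewrite big1// => i _; rewrite mxE mulr0.
Qed.

Lemma dual_normN x : N (- x) = N x.
Proof.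
by apply/eqP; rewrite eq_le !dual_norm_le// => i; rewrite mxE normrN.
Qed.

Lemma dual_norm_triangle x y : N (x + y) <= N x + N y.
Proof.
have [xi [<- xiz]] := dualN (x + y).
apply: le_trans (lerD (xiz x) (xiz y)).
rewrite -big_split/=; apply: ler_sum => i _.
by rewrite -mulrDr (le_trans (ler_norm _))// normrM mxE ler_wpM2l// ler_normD.
Qed.

Lemma dual_normZ a x : N (a *: x) = `|a| * N x.
Proof.
have le b y : N (b *: y) <= `|b| * N y.
  have [xi [<- /(_ y)]] := dualN (b *: y).
  move=> /(ler_wpM2l (normr_ge0 b)); apply: le_trans; rewrite mulr_sumr.
  by apply: ler_sum => i _; rewrite (le_trans (ler_norm _))// mxE !normrM mulrCA.
apply/eqP; rewrite eq_le le/=; have [->|a0] := eqVneq a 0.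
  by rewrite normr0 mul0r dual_norm_ge0.
rewrite -ler_pdivlMl ?normr_gt0// -normfV.
by rewrite {1}(_ : x = a^-1 *: (a *: x)) ?le// scalerA mulVf// scale1r.
Qed.

Lemma dual_norm_distC x y : N (x - y) = N (y - x).
Proof. by rewrite -dual_normN opprB. Qed.

Lemma dual_norm_le_norm x : N x <= N (const_mx 1) * `|x|.
Proof.
rewrite mulrC -[leRHS](_ : N (`|x| *: const_mx 1) = _); last first.
  by rewrite dual_normZ normr_id.
apply: dual_norm_le => i; rewrite !mxE mulr1 normr_id.
rewrite [leRHS]mx_normrE; exact: (le_bigmax 0 (fun i => `|x i.1 i.2|) (i, 0)).
Qed.

Lemma dual_norm_continuous : continuous N.
Proof.
move=> x; apply/(@cvgrPdist_le _ _ _ _ (nbhs_filter x)) => e e0.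
pose C := N (const_mx 1) + 1.
have C0 : 0 < C by rewrite ltr_wpDl ?dual_norm_ge0.
near=> y.
have le z t : N z - N t <= N (z - t).
  by rewrite lerBlDr (le_trans _ (dual_norm_triangle _ _))// subrK.
apply: (@le_trans _ _ (N (x - y))).
  by rewrite ler_norml le andbT lerNl opprB dual_norm_distC le.
apply: le_trans (dual_norm_le_norm _) _.
apply: (@le_trans _ _ (C * `|x - y|)); first by rewrite ler_wpM2r// lerDl.
rewrite -ler_pdivlMl// mulrC; near: y.
apply: (@cvgr_dist_le _ _ _ _ (nbhs_filter x) id x) => //; exact: divr_gt0.
Unshelve. all: by end_near. Qed.

Hypothesis defN : forall x, N x = 0 -> x = 0.

Lemma dual_norm_gt0 x : x != 0 -> 0 < N x.
Proof.
move=> x0; rewrite lt_neqAle dual_norm_ge0 andbT eq_sym.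
by apply: contra_neq x0; exact: defN.
Qed.

(** Pairing the norming functional of [e i] with [e i] itself shows that its coefficient at [i] is
    N(e i); hence N(e i) |x_i| <= N x, and the reciprocals are summed into one constant. The summand
    1 keeps [C] positive when [n = 0]. *)
Lemma norm_le_dual_norm : exists2 C, 0 < C & forall x, `|x| <= C * N x.
Proof.
pose e i : 'cV[R]_n := delta_mx i 0.
have eN i : 0 < N (e i).
  apply: dual_norm_gt0; apply/eqP => /colP /(_ i)/eqP.
  by rewrite !mxE !eqxx/= oner_eq0.
pose C := 1 + \sum_i (N (e i))^-1.
have C0 : 0 < C by rewrite ltr_pwDl// sumr_ge0// => i _; rewrite invr_ge0 ltW.
exists C => // x; rewrite [leLHS]mx_normrE; apply/bigmax_leP; split=> [|[i j] _].
  by rewrite mulr_ge0 ?dual_norm_ge0 ?ltW.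
rewrite (ord1 j) /=.
apply: (@le_trans _ _ ((N (e i))^-1 * N x)); last first.
  rewrite ler_wpM2r ?dual_norm_ge0// /C (bigD1 i)//= addrCA lerDl.
  by rewrite addr_ge0// sumr_ge0// => ? _; rewrite invr_ge0 ltW.
rewrite ler_pdivlMl//; have [xi [Ne /(_ x)]] := dualN (e i); apply: le_trans.
rewrite (bigD1 i)//= ler_wpDr ?sumr_ge0//.
rewrite ler_wpM2r// (le_trans _ (ler_norm _))// -Ne (bigD1 i)//= big1.
  by rewrite !mxE !eqxx mulr1 addr0.
by move=> k ki; rewrite !mxE (negPf ki) mulr0.
Qed.
End DualNorm.

(* Schur test: with z = w a, the norm of z to the power p is the sum of
   v_i w_i |a_i|^p, and B_ij w_j / (k w_i) is a Markov kernel that preserves the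
   measure v_i w_i. *)
Section SchurTest.
Context (R : realType) (n : nat) (B : 'M[R]_n) (v w eta : 'cV[R]_n) (k a b : R).
Hypothesis B_ge0 : forall i j, 0 <= B i j.
Hypothesis v_gt0 : forall i, 0 < v i 0.
Hypothesis w_gt0 : forall i, 0 < w i 0.
Hypothesis k_ge0 : 0 <= k.
Hypothesis vB : forall j, \sum_i v i 0 * B i j = k * v j 0.
Hypothesis Bw : forall i, \sum_j B i j * w j 0 = k * w i 0.
Hypothesis ab1 : a + b = 1.
Hypothesis eta_def : forall i, eta i 0 = v i 0 `^ a / w i 0 `^ b.

Lemma schur_eta_gt0 i : 0 < eta i 0.
Proof. by rewrite eta_def divr_gt0// powR_gt0. Qed.

(** Since b p = p - 1, the weight to the power p is v w^(1-p), and w^(1-p) |x|^p = w (|x| / w)^p.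
    The exponents 1/p and 1/q in eta are chosen for this. *)
Lemma powR_schur_eta p (x : 'cV[R]_n) i : 1 <= p -> a = p^-1 ->
  `|eta i 0 * x i 0| `^ p = v i 0 * w i 0 * (`|x i 0| / w i 0) `^ p.
Proof.
move=> p1 ap; have p0 : p != 0 by rewrite gt_eqF// (lt_le_trans _ p1).
have bE : b = 1 - p^-1 by rewrite -ap -ab1 addrC addKr.
rewrite normrM powRM// ger0_norm ?(ltW (schur_eta_gt0 _))//.
rewrite eta_def powRM ?powR_ge0 ?invr_ge0 ?powR_ge0//.
rewrite -powRrM ap mulVf// powRr1 ?(ltW (v_gt0 _))//.
rewrite -powRN -powRrM mulNr bE mulrBl mul1r mulVf// opprB.
rewrite [_ `^ (1 - p)]powRD ?powRr1 ?(ltW (w_gt0 _))//; last first.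
  by rewrite (gt_eqF (w_gt0 _)) implybT.
rewrite powRM ?invr_ge0 ?(ltW (w_gt0 _))//.
by rewrite -[(w i 0)^-1]powR_inv1 ?(ltW (w_gt0 _))// -powRrM mulN1r; ring.
Qed.

Lemma schur_test_fin p (z : 'cV[R]_n) : 1 <= p -> a = p^-1 -> vle 0 z ->
  wnorm p%:E (diagv eta) (B *m z) <= k * wnorm p%:E (diagv eta) z.
Proof.
move=> p1 ap z0; have p0 : 0 < p by exact: lt_le_trans p1.
have y0 i : 0 <= (B *m z) i 0.
  rewrite mxE sumr_ge0// => j _; rewrite mulr_ge0//.
  by have := z0 j; rewrite mxE.
have SE x : 0 < wnorm p%:E (diagv eta) x -> vle 0 x ->
    \sum_i v i 0 * w i 0 * (x i 0 / w i 0 / wnorm p%:E (diagv eta) x) `^ p = 1.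
  move=> Nx x0; have xi0 i : 0 <= x i 0 by have := x0 i; rewrite mxE.
  rewrite -[RHS](sum_powR_div_pnorm p1 Nx); apply: eq_bigr => i _.
  have wi := ltW (w_gt0 i); have Nx0 := ltW Nx.
  rewrite diagv_mulE [RHS]powRM ?invr_ge0// powR_schur_eta// ger0_norm//.
  by rewrite [in LHS]powRM ?invr_ge0 ?divr_ge0// mulrA.
have := pnorm_ge0 p%:E (diagv eta *m (B *m z)).
rewrite -/(wnorm _ _ _) le_eqVlt => /predU1P[<-|Ny].
  by rewrite mulr_ge0// pnorm_ge0.
have := pnorm_ge0 p%:E (diagv eta *m z).
rewrite -/(wnorm _ _ _) le_eqVlt => /predU1P[/esym Nz|Nz].
  rewrite (wnorm_eq0 _ _ Nz) ?mulmx0 ?lee_fin//; last first.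
    by move=> i; rewrite gt_eqF// schur_eta_gt0.
  by rewrite (dual_norm0 (dual_norm_wnorm eta _)) ?mulr0 ?lee_fin.
have y0' : vle 0 (B *m z) by move=> i; rewrite [leLHS]mxE.
have := SE _ Nz z0; have := SE _ Ny y0'.
move: (wnorm p%:E (diagv eta) z) Nz => Nz Nz0.
have : forall i, (B *m z) i 0 = \sum_j B i j * z j 0 by move=> i; rewrite mxE.
move: (wnorm p%:E (diagv eta) (B *m z)) Ny => Ny Ny0.
move: (B *m z) y0 {y0' SE} => y y0 yE SEy SEz.
pose al i := z i 0 / w i 0 / Nz; pose be i := y i 0 / w i 0 / Ny.
have w0 i : w i 0 != 0 by rewrite gt_eqF.
have al0 i : 0 <= al i.
  by have := z0 i; rewrite mxE => zi; rewrite !divr_ge0// ltW.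
have be0 i : 0 <= be i by rewrite !divr_ge0// ltW.
rewrite -ler_pdivrMr//.
(* Multiply by 1 = sum of v_i w_i be_i^p, detach one factor be_i from each power, and expand that
   factor y_i / (w_i Ny) along row i of [B]. *)
have -> : Ny / Nz = \sum_i \sum_j v i 0 * B i j * w j 0 * (al j * be i `^ (p - 1)).
  rewrite -[Ny]mulr1 -{1}SEy mulr_sumr mulr_suml; apply: eq_bigr => i _.
  rewrite -/(be i) -[_ `^ p](@mulr_powRB1 _ _ p)//.
  transitivity (v i 0 * y i 0 / Nz * be i `^ (p - 1)).
    by rewrite {1}/be; field; rewrite w0 !gt_eqF.
  rewrite yE mulr_sumr !mulr_suml; apply: eq_bigr => j _.
  by rewrite /al; field; rewrite w0 gt_eqF.
(* Young's inequality separates [al] from [be]. The first terms are summed over i by [vB], the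
   second over j by [Bw]; the totals k/p and k(1 - 1/p) add up to k. *)
apply: (@le_trans _ _ (\sum_i \sum_j v i 0 * B i j * w j 0 *
    (al j `^ p / p + (1 - p^-1) * be i `^ p))).
  apply: ler_sum => i _; apply: ler_sum => j _; rewrite ler_wpM2l//.
    by rewrite !mulr_ge0// ltW.
  exact: young_powR.
under eq_bigr do under eq_bigr do rewrite mulrDr.
under eq_bigr do rewrite big_split/=.
rewrite big_split/= exchange_big/=.
have -> : \sum_j \sum_i v i 0 * B i j * w j 0 * (al j `^ p / p) = k / p.
  transitivity (\sum_j k / p * (v j 0 * w j 0 * al j `^ p)).
    apply: eq_bigr => j _; rewrite -mulr_suml -mulr_suml vB; ring.
  by rewrite -mulr_sumr SEz mulr1.
have -> : \sum_i \sum_j v i 0 * B i j * w j 0 * ((1 - p^-1) * be i `^ p) =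
    k * (1 - p^-1).
  transitivity (\sum_i k * (1 - p^-1) * (v i 0 * w i 0 * be i `^ p)).
    apply: eq_bigr => i _; rewrite -mulr_suml.
    under eq_bigr do rewrite -mulrA.
    rewrite -mulr_sumr Bw; ring.
  by rewrite -mulr_sumr SEy mulr1.
by rewrite -mulrDr addrC subrK mulr1.
Qed.

(** At this endpoint eta = 1 / w, so z_j is at most w_j times the norm of [z], and [Bw] sums each
    row. *)
Lemma schur_test_infty (z : 'cV[R]_n) : a = 0 -> vle 0 z ->
  wnorm +oo%E (diagv eta) (B *m z) <= k * wnorm +oo%E (diagv eta) z.
Proof.
move=> a0 z0; have b1 : b = 1 by rewrite -ab1 a0 add0r.
have etaE i : eta i 0 = (w i 0)^-1.
  by rewrite eta_def a0 b1 powRr0 powRr1 ?div1r// ltW.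
apply/bigmax_leP; split=> [|i _]; first by rewrite mulr_ge0// pnorm_ge0.
rewrite diagv_mulE etaE ger0_norm; last first.
  rewrite mulr_ge0// ?invr_ge0 ?(ltW (w_gt0 _))// mxE sumr_ge0// => j _.
  by rewrite mulr_ge0//; have := z0 j; rewrite mxE.
rewrite ler_pdivrMl// mulrA [w i 0 * k]mulrC -Bw mulr_suml mxE.
apply: ler_sum => j _; rewrite -mulrA ler_wpM2l// -ler_pdivrMl//.
apply: le_trans (le_bigmax 0 (fun i => `|(diagv eta *m z) i 0|) j).
by rewrite diagv_mulE etaE ler_norm.
Qed.
End SchurTest.

(** * Linear scalar integral equations *)

Lemma integrable_itvS (R : realType) (a b c d : R) (f : R -> R) :
  (@lebesgue_measure R).-integrable `[a, b] (EFin \o f) ->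
  a <= c -> d <= b -> (@lebesgue_measure R).-integrable `[c, d] (EFin \o f).
Proof.
move=> fi ac db; apply: integrableS fi => //.
by apply: subset_itv; rewrite bnd_simp.
Qed.

Lemma continuous_itv_integrable (R : realType) (a b : R) (f : R -> R) :
  {within `[a, b], continuous f} ->
  (@lebesgue_measure R).-integrable `[a, b] (EFin \o f).
Proof. by apply: continuous_compact_integrable; exact: segment_compact. Qed.

Lemma is_derive_expR_scale (R : realType) (k x : R) :
  is_derive x 1 (fun s => expR (k * s)) (k * expR (k * x)).
Proof.
have kx : is_derive x 1 (fun s : R => k * s) k.
  have := @is_deriveZ _ _ _ id k x 1 1 _; move/(_ _)/is_derive_eq; apply => //.
  by rewrite /GRing.scale/= mulr1.
have := is_derive1_comp (is_derive_expR (k * x)) kx.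
by rewrite mulrC.
Qed.

Lemma Rintegral_expR (R : realType) (k x y : R) : x <= y ->
  \int[@lebesgue_measure R]_(s in `[x, y]) (k * expR (k * s)) =
  expR (k * y) - expR (k * x).
Proof.
rewrite le_eqVlt => /predU1P[<-|xy].
  by rewrite set_itv1 Rintegral_set1 subrr.
have cE : continuous (fun s => expR (k * s)).
  move=> s; apply: differentiable_continuous; apply/derivable1_diffP.
  by have [] := is_derive_expR_scale k s.
rewrite /Rintegral (@continuous_FTC2 _ _ (fun s => expR (k * s)))//.
- by apply: continuous_subspaceT => s; apply: cvgM; [exact: cvg_cst|exact: cE].
- split.
  + by move=> s _; have [] := is_derive_expR_scale k s.
  + by apply: cvg_at_right_filter; exact: cE.
  + by apply: cvg_at_left_filter; exact: cE.
- by move=> s _; rewrite derive1E; have [_ ->] := is_derive_expR_scale k s.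
Qed.

Lemma continuous_expR_scale (R : realType) (k : R) :
  continuous (fun s : R => expR (k * s)).
Proof.
move=> s; apply: differentiable_continuous; apply/derivable1_diffP.
by have [] := is_derive_expR_scale k s.
Qed.

(* At a maximum of [D t * expR (- 2 k t)] the hypothesis halves the maximum. *)
Lemma gronwall_le0 (R : realType) (D : R -> R) (k a b : R) : 0 <= k ->
  {within `[a, b], continuous D} ->
  (forall t, a <= t -> t <= b ->
    D t <= k * \int[@lebesgue_measure R]_(s in `[a, t]) D s) ->
  forall t, a <= t -> t <= b -> D t <= 0.
Proof.
rewrite le_eqVlt => /predU1P[<- _ H t ta tb|k0 cD H].
  by have := H t ta tb; rewrite mul0r.
pose E t := expR (2 * k * t).
have E0 t : 0 < E t by exact: expR_gt0.
have cE : continuous E by exact: continuous_expR_scale.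
move=> t ta tb; have ab := le_trans ta tb.
have cf : {within `[a, b], continuous (fun t => D t / E t)}.
  move=> s; apply: cvgM; first exact: cD.
  apply: cvgV; first by rewrite gt_eqF.
  by apply: continuous_subspaceT.
have [c cab fc] := EVT_max ab cf.
have DE s : a <= s -> s <= b -> D s <= D c / E c * E s.
  by move=> sa sb; rewrite -ler_pdivrMr// fc// in_itv/= sa.
have Dt : D t <= D c / E c * E t by exact: DE.
apply: le_trans Dt _; rewrite pmulr_lle0// pmulr_lle0 ?invr_gt0//.
rewrite leNgt; apply/negP => Dc0.
have /andP[ac cb] : a <= c <= b by rewrite in_itv in cab.
have := H c ac cb; rewrite leNgt => /negP; apply.
have iE x : (@lebesgue_measure R).-integrable `[a, c]
    (EFin \o (fun s => x * E s)).
  apply: continuous_itv_integrable; apply: continuous_subspaceT => s.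
  by apply: cvgM; [exact: cvg_cst|exact: cE].
apply: (@le_lt_trans _ _ (k * \int[@lebesgue_measure R]_(s in `[a, c])
    (D c / E c * E s))).
  rewrite ler_wpM2l ?(ltW k0)//; apply: le_Rintegral => //.
    by apply: integrable_itvS (continuous_itv_integrable cD) _ _.
  by move=> s /=; rewrite in_itv/= => /andP[sa sc]; rewrite DE// (le_trans sc).
have -> : \int[@lebesgue_measure R]_(s in `[a, c]) (D c / E c * E s) =
    D c / E c / (2 * k) * (E c - E a).
  rewrite -Rintegral_expR// -RintegralZl//.
  by apply: eq_Rintegral => s _; rewrite mulrA divfK// gt_eqF// mulr_gt0.
have -> : k * (D c / E c / (2 * k) * (E c - E a)) = D c / 2 * (1 - E a / E c).
  by field; rewrite !gt_eqF.
apply: (@le_lt_trans _ _ (D c / 2)); last by rewrite ltr_pdivrMr// ltr_pMr// ltr1n.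
by rewrite ger_pMr ?divr_gt0// gerBl divr_ge0// ltW.
Qed.

Lemma Rintegrable_scale d (T : measurableType d) (R : realType)
    (mu : {measure set T -> \bar R}) (D : set T) (k : R) (f : T -> R) :
  measurable D -> mu.-integrable D (EFin \o f) ->
  mu.-integrable D (EFin \o (fun x => k * f x)).
Proof.
by move=> mD fi; apply: eq_integrable (integrableZl mD k fi).
Qed.

Lemma Rintegrable_add d (T : measurableType d) (R : realType)
    (mu : {measure set T -> \bar R}) (D : set T) (f g : T -> R) :
  measurable D -> mu.-integrable D (EFin \o f) ->
  mu.-integrable D (EFin \o g) ->
  mu.-integrable D (EFin \o (fun x => f x + g x)).
Proof.
by move=> mD fi gi; apply: eq_integrable (integrableD mD fi gi).
Qed.

Lemma Rintegrable_sub d (T : measurableType d) (R : realType)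
    (mu : {measure set T -> \bar R}) (D : set T) (f g : T -> R) :
  measurable D -> mu.-integrable D (EFin \o f) ->
  mu.-integrable D (EFin \o g) ->
  mu.-integrable D (EFin \o (fun x => f x - g x)).
Proof.
by move=> mD fi gi; apply: eq_integrable (integrableB mD fi gi).
Qed.

Lemma Rintegrable_sum d (T : measurableType d) (R : realType)
    (mu : {measure set T -> \bar R}) (D : set T) (n : nat)
    (f : 'I_n -> T -> R) :
  measurable D -> (forall i, mu.-integrable D (EFin \o f i)) ->
  mu.-integrable D (EFin \o (fun x => \sum_i f i x)).
Proof.
move=> mD fi; rewrite (_ : EFin \o _ = fun x => (\sum_i (EFin \o f i) x)%E).
  by apply: integrable_sum => // i _; exact: fi.
by apply/funext => x; rewrite /= sumEFin.
Qed.

Lemma Rintegral_sum d (T : measurableType d) (R : realType)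
    (mu : {measure set T -> \bar R}) (D : set T) (n : nat)
    (f : 'I_n -> T -> R) :
  measurable D -> (forall i, mu.-integrable D (EFin \o f i)) ->
  \int[mu]_(x in D) (\sum_i f i x) = \sum_i \int[mu]_(x in D) f i x.
Proof.
move=> mD; elim: n f => [|n IH] f fi.
  under eq_Rintegral do rewrite big_ord0.
  by rewrite big_ord0 Rintegral_cst// mul0r.
under eq_Rintegral do rewrite big_ord_recl.
rewrite RintegralD// ?big_ord_recl ?IH//.
exact: Rintegrable_sum.
Qed.

Lemma EFin_Rintegral d (T : measurableType d) (R : realType)
    (mu : {measure set T -> \bar R}) (D : set T) (f : T -> R) :
  measurable D -> mu.-integrable D (EFin \o f) ->
  (\int[mu]_(x in D) (f x)%:E)%E = (\int[mu]_(x in D) f x)%:E.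
Proof. by move=> mD fi; rewrite /Rintegral fineK// integrable_fin_num. Qed.

Lemma patch_itvE (R : realType) (f : R -> R) (a b s : R) :
  (f \_ `[a, b]) s = if a <= s <= b then f s else 0.
Proof. by rewrite patchE mem_setE in_itv. Qed.

(** Fubini on the triangle a <= t <= s <= b. It plays the role of integration by parts for functions
    that are only integrable. *)
Lemma Rintegral_triangle (R : realType) (a b : R) (g h : R -> R) :
  (@lebesgue_measure R).-integrable `[a, b] (EFin \o g) ->
  (@lebesgue_measure R).-integrable `[a, b] (EFin \o h) ->
  \int[@lebesgue_measure R]_(s in `[a, b])
    (g s * \int[@lebesgue_measure R]_(t in `[a, s]) h t) =
  \int[@lebesgue_measure R]_(t in `[a, b])
    (h t * \int[@lebesgue_measure R]_(s in `[t, b]) g s).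
Proof.
move=> gi hi; pose mu := @lebesgue_measure R.
(* Extension by zero moves both iterated integrals to the whole line; the triangle survives as the
   test [z.2 <= z.1] in [f]. *)
pose G : R -> R := g \_ `[a, b]; pose H : R -> R := h \_ `[a, b].
have restr_int (f : R -> R) c d : mu.-integrable `[c, d] (EFin \o f) ->
    mu.-integrable setT (EFin \o (f \_ `[c, d])).
  by move=> fi; rewrite -restrict_EFin -integrable_mkcond.
have Gi := restr_int _ _ _ gi; have Hi := restr_int _ _ _ hi.
have mG : measurable_fun setT G by move: (measurable_int mu Gi) => /measurable_EFinP.
have mH : measurable_fun setT H by move: (measurable_int mu Hi) => /measurable_EFinP.
pose f (z : measurableTypeR R * measurableTypeR R) : \bar R :=
  (if z.2 <= z.1 then G z.1 * H z.2 else 0)%:E.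
have mf : measurable_fun setT f.
  apply/measurable_EFinP; apply: measurable_fun_ifT => //.
    exact: measurable_fun_ler.
  by apply: measurable_funM; exact: measurableT_comp.
have fi : (mu \x mu)%E.-integrable setT f.
  apply/integrable12ltyP => //.
  apply: (@le_lt_trans _ _ (\int[mu]_x ((`|G x| * \int[mu]_y `|H y|)%:E))%E).
    apply: ge0_le_integral => //=.
    - by move=> s _; exact: integral_ge0.
    - apply: (@measurable_fun_fubini_tonelli_F _ _ _ _ _ mu (abse \o f)) => //.
        exact: measurableT_comp.
      by move=> z; exact: abse_ge0.
    - apply/measurable_EFinP; apply: measurable_funM => //.
      exact: measurableT_comp.
    - move=> s _; rewrite EFinM -EFin_Rintegral//; last exact: integrable_norm.
      rewrite -ge0_integralZl_EFin//; last first.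
        by apply/measurable_EFinP; exact: measurableT_comp.
      apply: ge0_le_integral => //.
      + apply/measurable_EFinP; apply: measurableT_comp => //.
        apply: measurable_fun_ifT => //; first exact: measurable_fun_ler.
        exact: measurable_funM.
      + apply/measurable_EFinP; apply: measurable_funM => //.
        exact: measurableT_comp.
      + move=> t _; rewrite -EFinM lee_fin; case: ifP => _; first by rewrite normrM.
        by rewrite normr0 mulr_ge0.
  under eq_integral do rewrite EFinM.
  apply: integrable_lty => //; apply: integrableZr => //.
  exact: integrable_norm.
have inner1 s : (\int[mu]_t f (s, t))%E =
    (((fun s => g s * \int[mu]_(t in `[a, s]) h t) \_ `[a, b]) s)%:E.
  rewrite patch_itvE; case: ifPn => [/andP[sa sb]|sab]; last first.
    rewrite integral0_eq// => t _.
    by rewrite /f/= /G patch_itvE (negPf sab) mul0r if_same.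
  rewrite [X in _ * X]Rintegral_mkcond.
  have hs : mu.-integrable setT (EFin \o (h \_ `[a, s])).
    by apply: restr_int; apply: integrable_itvS hi _ _.
  rewrite -RintegralZl// -EFin_Rintegral//; last exact: Rintegrable_scale.
  apply: eq_integral => t _; rewrite /f/= /G /H !patch_itvE sa sb /=.
  have [ts|ts] := leP t s; last by rewrite andbF mulr0.
  by rewrite (le_trans ts sb).
have inner2 t : (\int[mu]_s f (s, t))%E =
    (((fun t => h t * \int[mu]_(s in `[t, b]) g s) \_ `[a, b]) t)%:E.
  rewrite patch_itvE; case: ifPn => [/andP[ta tb]|tab]; last first.
    rewrite integral0_eq// => s _.
    by rewrite /f/= /H patch_itvE (negPf tab) mulr0 if_same.
  rewrite [X in _ * X]Rintegral_mkcond.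
  have gt : mu.-integrable setT (EFin \o (g \_ `[t, b])).
    by apply: restr_int; apply: integrable_itvS gi _ _.
  rewrite -RintegralZl// -EFin_Rintegral//; last exact: Rintegrable_scale.
  apply: eq_integral => s _; rewrite /f/= /G /H !patch_itvE ta tb /= mulrC.
  have [ts|ts] := leP t s; last by rewrite mulr0.
  by rewrite (le_trans ta ts).
rewrite [LHS]Rintegral_mkcond [RHS]Rintegral_mkcond /Rintegral.
congr fine; transitivity (\int[mu]_s \int[mu]_t f (s, t))%E.
  by apply: eq_integral => s _; rewrite inner1.
rewrite (Fubini fi); apply: eq_integral => t _.
by rewrite [LHS]inner2.
Qed.

Lemma Rintegrable_continuousM (R : realType) (a b : R) (g h : R -> R) :
  {within `[a, b], continuous g} ->
  (@lebesgue_measure R).-integrable `[a, b] (EFin \o h) ->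
  (@lebesgue_measure R).-integrable `[a, b] (EFin \o (fun s => g s * h s)).
Proof.
move=> cg hi.
apply: (@integrableMr _ _ _ lebesgue_measure `[a, b] (measurable_itv _) g) hi.
  by apply: subspace_continuous_measurable_fun => //; exact: measurable_itv.
have /compact_bounded[M [_ mrt]] := continuous_compact cg (@segment_compact _ a b).
by exists M; split; rewrite ?num_real => // ? ? ? ?; exact: mrt.
Qed.

Lemma voc_integrable (R : realType) (r a b t : R) (h : R -> R) : t <= b ->
  (@lebesgue_measure R).-integrable `[a, b] (EFin \o h) ->
  (@lebesgue_measure R).-integrable `[a, t]
    (EFin \o (fun s => expR (r * (t - s)) * h s)).
Proof.
move=> tb hi; apply: Rintegrable_continuousM; last exact: integrable_itvS hi _ _.
apply: (@subspace_eq_continuous _ _ _ (fun s => expR (r * t) * expR (- r * s))).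
  by move=> s _; rewrite -expRD /from_subspace; congr expR; ring.
apply: continuous_subspaceT => s.
by apply: cvgM; [exact: cvg_cst|exact: continuous_expR_scale].
Qed.

(* Variation-of-constants formula for u' = r u + h, u(a) = u0. *)
Definition voc (R : realType) (r a u0 : R) (h : R -> R) (t : R) : R :=
  expR (r * (t - a)) * u0 +
  \int[@lebesgue_measure R]_(s in `[a, t]) (expR (r * (t - s)) * h s).

Section VariationOfConstants.
Context (R : realType) (r a b : R) (h : R -> R).
Hypothesis hi : (@lebesgue_measure R).-integrable `[a, b] (EFin \o h).

Let k (s : R) := expR (- r * s) * h s.

Let ki t : t <= b -> (@lebesgue_measure R).-integrable `[a, t] (EFin \o k).
Proof.
move=> tb; apply: Rintegrable_continuousM; last exact: integrable_itvS hi _ _.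
by apply: continuous_subspaceT; exact: continuous_expR_scale.
Qed.

Let P (t : R) := \int[@lebesgue_measure R]_(s in `[a, t]) k s.

(** With e^(r t) pulled out of the kernel, the integrand no longer depends on [t], so continuity
    reduces to that of the primitive [P]. *)
Let vocE u0 t : t <= b ->
  voc r a u0 h t = expR (r * t) * (expR (- r * a) * u0 + P t).
Proof.
move=> tb; rewrite /voc [RHS]mulrDr mulrA -expRD mulNr -mulrBr; congr (_ + _).
rewrite -RintegralZl//; last exact: ki.
by apply: eq_Rintegral => s _; rewrite /k mulrA -expRD mulNr -mulrBr.
Qed.

Let cP : {within `[a, b], continuous P}.
Proof.
have [ab|ba] := leP a b; first by apply: parameterized_integral_continuous => //; exact: ki.
by rewrite set_itv_ge ?bnd_simp -?ltNge//; exact: continuous_subspace0.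
Qed.

Lemma voc_continuous u0 : {within `[a, b], continuous (voc r a u0 h)}.
Proof.
apply: (@subspace_eq_continuous _ _ _ (fun t => expR (r * t) * (expR (- r * a) * u0 + P t))).
  by move=> t; rewrite inE/= in_itv/= => /andP[_ tb]; exact/esym/vocE.
move=> t; apply: cvgM.
  by apply: continuous_subspaceT; exact: continuous_expR_scale.
by apply: cvgD; [exact: cvg_cst|exact: cP].
Qed.

(** As [h] is only integrable, the formula cannot be differentiated at every point. Instead the
    integral of r e^(r s) P(s) is evaluated by exchanging the order of integration: the inner
    integral is e^(r t) - e^(r s), whose second term cancels the e^(-r s) in [k] and gives back
    [h]. *)
Lemma voc_integral_eq u0 t : a <= t -> t <= b ->
  voc r a u0 h t = u0 + \int[@lebesgue_measure R]_(s in `[a, t])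
    (r * voc r a u0 h s + h s).
Proof.
move=> at_ tb; rewrite RintegralD//; first last.
- exact: integrable_itvS hi _ _.
- apply: Rintegrable_scale => //; apply: integrable_itvS (_ : _ <= _) tb => //.
  exact: continuous_itv_integrable (@voc_continuous u0).
have Ei : (@lebesgue_measure R).-integrable `[a, t]
    (EFin \o (fun s => r * expR (r * s))).
  apply: Rintegrable_scale => //; apply: continuous_itv_integrable.
  by apply: continuous_subspaceT; exact: continuous_expR_scale.
have cPt : {within `[a, t], continuous P}.
  by apply: continuous_subspaceW cP; apply: subset_itvl; rewrite bnd_simp.
transitivity (u0 + (expR (- r * a) * u0 * (expR (r * t) - expR (r * a)) +
    \int[@lebesgue_measure R]_(s in `[a, t]) (r * expR (r * s) * P s) +
    \int[@lebesgue_measure R]_(s in `[a, t]) h s)).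
  rewrite Rintegral_triangle//; last exact: ki.
  have -> : \int[lebesgue_measure]_(s in `[a, t])
     (k s * \int[lebesgue_measure]_(s0 in `[s, t]) (r * expR (r * s0))) =
     expR (r * t) * P t - \int[lebesgue_measure]_(s in `[a, t]) h s.
    rewrite -RintegralZl//; last exact: ki.
    rewrite -RintegralB//; last 2 first.
    - by apply: Rintegrable_scale => //; exact: ki.
    - exact: integrable_itvS hi _ _.
    apply: eq_Rintegral => s; rewrite inE/= in_itv/= => /andP[_ st].
    rewrite Rintegral_expR// mulrBr [k s * expR (r * t)]mulrC.
    by rewrite {2}/k mulrAC -expRD mulNr addNr expR0 mul1r.
  rewrite vocE// mulNr expRN; field.
  by rewrite gt_eqF// expR_gt0.
congr (_ + (_ + _)).
have mD : measurable (`[a, t]%classic : set (measurableTypeR R)) by [].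
have i1 := Rintegrable_scale (expR (- r * a) * u0) mD Ei.
have i2 : (@lebesgue_measure R).-integrable `[a, t]
    (EFin \o (fun s => r * expR (r * s) * P s)).
  apply: continuous_itv_integrable => s; apply: cvgM; last exact: cPt.
  apply: cvgM; first exact: cvg_cst.
  by apply: continuous_subspaceT; exact: continuous_expR_scale.
rewrite -(Rintegral_expR r at_) -(RintegralZl _ mD Ei).
rewrite -(RintegralD mD i1 i2).
apply: eq_Rintegral => s; rewrite inE/= in_itv/= => /andP[_ st].
by rewrite vocE ?(le_trans st)//; ring.
Qed.

(** The forcing cancels in the difference [D] of [u] and the formula; what remains, D = r times its
    own integral, forces D = 0 by Gronwall applied to |D| with constant |r|. *)
Lemma voc_unique (u : R -> R) : {within `[a, b], continuous u} ->
  (forall t, a <= t -> t <= b -> u t = u a +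
    \int[@lebesgue_measure R]_(s in `[a, t]) (r * u s + h s)) ->
  forall t, a <= t -> t <= b -> u t = voc r a (u a) h t.
Proof.
move=> cu uE; pose D t := u t - voc r a (u a) h t.
have cv := @voc_continuous (u a).
have cD : {within `[a, b], continuous D}.
  by move=> t; apply: cvgB; [exact: cu|exact: cv].
have Di t : t <= b -> (@lebesgue_measure R).-integrable `[a, t] (EFin \o D).
  by move=> tb; apply: integrable_itvS (continuous_itv_integrable cD) _ _.
have DE t : a <= t -> t <= b ->
    D t = r * \int[@lebesgue_measure R]_(s in `[a, t]) D s.
  move=> at_ tb; rewrite /D uE// voc_integral_eq// opprD addrACA subrr add0r.
  rewrite -RintegralB//; last 2 first.
  - apply: Rintegrable_add => //; last exact: integrable_itvS hi _ _.
    apply: Rintegrable_scale => //; apply: integrable_itvS (_ : _ <= _) tb => //.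
    exact: continuous_itv_integrable.
  - apply: Rintegrable_add => //; last exact: integrable_itvS hi _ _.
    apply: Rintegrable_scale => //; apply: integrable_itvS (_ : _ <= _) tb => //.
    exact: continuous_itv_integrable.
  rewrite -RintegralZl//; last exact: Di.
  by apply: eq_Rintegral => s _; ring.
have := @gronwall_le0 R (fun t => `|D t|) `|r| a b (normr_ge0 _) _ _.
move=> H t ta tb; apply/eqP; rewrite -subr_eq0 -normr_le0; apply: H ta tb.
  by move=> s; apply: cvg_norm; exact: cD.
move=> s sa sb; rewrite DE// normrM ler_wpM2l// le_normr_Rintegral//; exact: Di.
Qed.
End VariationOfConstants.

(* The bound solves the equality case of the hypothesis, so the difference
   falls under [gronwall_le0]. *)
Lemma voc_comparison (R : realType) (m k a b u0 : R) (phi beta : R -> R) :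
  0 <= k -> {within `[a, b], continuous phi} ->
  (@lebesgue_measure R).-integrable `[a, b] (EFin \o beta) ->
  (forall t, a <= t -> t <= b ->
    phi t <= voc (- m) a u0 (fun s => k * phi s + beta s) t) ->
  forall t, a <= t -> t <= b -> phi t <= voc (k - m) a u0 beta t.
Proof.
move=> k0 cphi ib H; pose S := voc (k - m) a u0 beta.
have cS : {within `[a, b], continuous S} by exact: voc_continuous.
have Sa : S a = u0.
  by rewrite /S /voc subrr mulr0 expR0 mul1r set_itv1 Rintegral_set1 addr0.
have ik (f : R -> R) : {within `[a, b], continuous f} ->
    (@lebesgue_measure R).-integrable `[a, b] (EFin \o (fun s => k * f s + beta s)).
  move=> cf; apply: Rintegrable_add => //; apply: Rintegrable_scale => //.
  exact: continuous_itv_integrable.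
(* The equation of [S] with rate k - m is regrouped as one with rate -m and forcing k S + beta, the
   shape of the hypothesis on [phi]. *)
have SE t : a <= t -> t <= b ->
    S t = voc (- m) a u0 (fun s => k * S s + beta s) t.
  move=> at_ tb; rewrite -{1}Sa; apply: (@voc_unique _ _ a b) => //.
    exact: ik.
  move=> {at_ tb}t at_ tb; rewrite Sa {1}/S (voc_integral_eq _ ib)//; congr (_ + _).
  by apply: eq_Rintegral => s _; rewrite -/S; ring.
(* The factor e^(m t) turns the kernel e^(-m(t-s)) into e^(m s); beta and the initial value cancel,
   and [E] is bounded by k times its own integral. *)
pose E t := expR (m * t) * (phi t - S t).
have cE : {within `[a, b], continuous E}.
  move=> t; apply: cvgM.
    by apply: continuous_subspaceT; exact: continuous_expR_scale.
  by apply: cvgB; [exact: cphi|exact: cS].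
have HE t : a <= t -> t <= b ->
    E t <= k * \int[@lebesgue_measure R]_(s in `[a, t]) E s.
  move=> at_ tb; have mD : measurable (`[a, t]%classic : set (measurableTypeR R)) by [].
  have iE : (@lebesgue_measure R).-integrable `[a, t] (EFin \o E).
    exact: integrable_itvS (continuous_itv_integrable cE) _ _.
  rewrite -(RintegralZl _ mD iE) /E mulrBr lerBlDr.
  apply: le_trans (ler_wpM2l (expR_ge0 _) (H t at_ tb)) _.
  rewrite SE// /voc !mulrDr addrCA lerD2l.
  rewrite -(RintegralZl _ mD (voc_integrable _ tb (ik _ cphi))).
  rewrite -(RintegralZl _ mD (voc_integrable _ tb (ik _ cS))).
  rewrite -RintegralD//; last 2 first.
  - by apply: Rintegrable_scale.
  - by apply: Rintegrable_scale => //; apply: voc_integrable (ik _ cS).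
  apply: le_Rintegral => //.
  - by apply: Rintegrable_scale => //; apply: voc_integrable (ik _ cphi).
  - apply: Rintegrable_add => //; first exact: Rintegrable_scale.
    by apply: Rintegrable_scale => //; apply: voc_integrable (ik _ cS).
  move=> s _; rewrite le_eqVlt; apply/orP; left; apply/eqP.
  rewrite ![expR (m * t) * (_ * _)]mulrA -!expRD.
  have -> : m * t + - m * (t - s) = m * s by ring.
  by ring.
move=> t at_ tb; have := gronwall_le0 k0 cE HE at_ tb.
by rewrite pmulr_rle0 ?expR_gt0// subr_le0.
Qed.

(** * Systems x' = H(x) - m x + u(t) *)

Definition measurable_norm (R : realType) (n : nat) (N : 'cV[R]_n -> R) : Prop :=
  forall (D : set R) (f : R -> 'cV[R]_n), measurable D ->
    (forall i, measurable_fun D (fun s => f s i 0)) ->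
    measurable_fun D (fun s => N (f s)).

Lemma measurable_norm_wnorm (R : realType) (n : nat) (p : \bar R)
    (eta : 'cV[R]_n) : measurable_norm (wnorm p (diagv eta)).
Proof.
move=> D f mD mf.
have mef i : measurable_fun D (fun s => `|(diagv eta *m f s) i 0|).
  apply: measurableT_comp => //.
  under eq_fun do rewrite diagv_mulE.
  by apply: measurable_funM.
rewrite /wnorm /pnorm; case: p => [p| |] //.
  apply: (@measurableT_comp _ _ _ _ _ _ (@powR R ^~ p^-1)) => //.
  apply: measurable_sum => i.
  by apply: (@measurableT_comp _ _ _ _ _ _ (@powR R ^~ p)).
rewrite (_ : (fun s => _) =
    \big[(fun g h : R -> R => (g \max h)%R)/(cst 0)]_(i < n)
      (fun s => `|(diagv eta *m f s) i 0|)); last first.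
  apply/funext => s; elim/big_ind2 : _ => //= x1 x2 y1 y2 -> ->.
  by [].
elim/big_ind : _ => //= u1 u2 mu1 mu2; exact: measurable_maxr.
Qed.

Section DualNormIntegral.
Context (R : realType) (n : nat) (N : 'cV[R]_n -> R).
Hypothesis dualN : dual_norm N.
Hypothesis mN : measurable_norm N.
Context (D : set R) (mD : measurable D) (f : R -> 'cV[R]_n).
Hypothesis fi : forall i,
  (@lebesgue_measure R).-integrable D (EFin \o (fun s => f s i 0)).

Lemma dual_norm_integrable :
  (@lebesgue_measure R).-integrable D (EFin \o (fun s => N (f s))).
Proof.
apply: (@le_integrable _ _ _ lebesgue_measure D mD _
    (EFin \o (fun s => N (const_mx 1) * \sum_i `|f s i 0|))).
- apply/measurable_EFinP; apply: mN => // i.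
  by move: (measurable_int lebesgue_measure (fi i)) => /measurable_EFinP.
- move=> s _; rewrite lee_fin ger0_norm ?dual_norm_ge0// [leRHS]ger0_norm; last first.
    by rewrite mulr_ge0 ?dual_norm_ge0// sumr_ge0.
  apply: le_trans (dual_norm_le_norm dualN _) _.
  rewrite ler_wpM2l ?dual_norm_ge0// [leLHS]mx_normrE.
  apply/bigmax_leP; split=> [|[i j] _] /=; first exact: sumr_ge0.
  by rewrite (ord1 j) (bigD1 i)//= lerDl sumr_ge0.
- apply: Rintegrable_scale => //; apply: Rintegrable_sum => // i.
  exact: integrable_norm.
Qed.

(** The norming functional of the integrated vector is linear, hence commutes with the integral, and
    under the integral sign it is bounded by [N]. *)
Lemma dual_norm_Rintegral :
  N (\col_i \int[@lebesgue_measure R]_(s in D) f s i 0) <=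
  \int[@lebesgue_measure R]_(s in D) N (f s).
Proof.
have [xi [<- xiz]] := dualN (\col_i \int[@lebesgue_measure R]_(s in D) f s i 0).
apply: (@le_trans _ _ (\int[@lebesgue_measure R]_(s in D) (\sum_i xi i * f s i 0))).
  rewrite Rintegral_sum//; last by move=> i; exact: Rintegrable_scale.
  by apply: ler_sum => i _; rewrite mxE RintegralZl.
apply: le_Rintegral => //.
- by apply: Rintegrable_sum => // i; exact: Rintegrable_scale.
- exact: dual_norm_integrable.
- move=> s _; apply: le_trans (xiz (f s)); apply: ler_sum => i _.
  by rewrite -normrM ler_norm.
Qed.
End DualNormIntegral.

Lemma cV_cvg (R : realType) (n : nat) (T : Type) (F : set_system T)
    (FF : Filter F) (x : T -> 'cV[R]_n) (l : 'cV[R]_n) :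
  (forall i, x t i 0 @[t --> F] --> l i 0) -> x t @[t --> F] --> l.
Proof.
move=> xl; apply/cvgrPdist_le => e e0.
have : \forall t \near F, forall i, `|l i 0 - x t i 0| <= e.
  by apply: filter_forall => i; apply: (@cvgr_dist_le _ _ _ _ _ _ _ (xl i)).
apply: filterS => t H; rewrite [leLHS]mx_normrE.
apply/bigmax_leP; split=> [|[i j] _]; first exact: ltW.
by rewrite (ord1 j)/=; move: (H i); rewrite !mxE.
Qed.

Lemma cV_within_continuous (R : realType) (n : nat) (A : set R)
    (x : R -> 'cV[R]_n) :
  (forall i, {within A, continuous (fun t => x t i 0)}) ->
  {within A, continuous x}.
Proof.
move=> cx t; apply: cV_cvg => i; exact: cx.
Qed.

Lemma within_continuous_coord (R : realType) (n : nat) (A : set R)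
    (x : R -> 'cV[R]_n) i :
  {within A, continuous x} -> {within A, continuous (fun t => x t i 0)}.
Proof.
move=> cx t.
apply: (@continuous_comp _ _ _ (x : subspace A -> _) (fun M : 'cV[R]_n => M i 0)).
  exact: cx.
exact: coord_continuous.
Qed.

Lemma continuous_within_comp (R : realType) (U V : topologicalType) (A : set R)
    (x : R -> U) (h : U -> V) :
  continuous h -> {within A, continuous x} -> {within A, continuous (h \o x)}.
Proof.
move=> ch cx t.
apply: (@continuous_comp _ _ _ (x : subspace A -> _) h); [exact: cx|exact: ch].
Qed.

Lemma solution_continuous (R : realType) (n : nat)
    (f : R -> 'cV[R]_n -> 'cV[R]_n) (t0 T : R) (x : R -> 'cV[R]_n) :
  solution f t0 x -> {within `[t0, T], continuous x}.
Proof.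
move=> xs; have [t0T|] := leP t0 T; last first.
  by move=> Tt0; rewrite set_itv_ge ?bnd_simp -?ltNge//; exact: continuous_subspace0.
apply: cV_within_continuous => i.
have fi := (xs T t0T i).1.
apply: (@subspace_eq_continuous _ _ _
  (fun t => x t0 i 0 + \int[lebesgue_measure]_(s in `[t0, t]) f s (x s) i 0)).
  by move=> t; rewrite inE/= in_itv/= => /andP[ta _]; exact/esym/(xs t ta i).2.
move=> t; apply: cvgD; first exact: cvg_cst.
exact: (@parameterized_integral_continuous _ t0 T).
Qed.

Section DecaySystem.
Context (R : realType) (n : nat) (H : 'cV[R]_n -> 'cV[R]_n) (m : R).
Hypothesis cH : continuous H.

Implicit Types (x y u : R -> 'cV[R]_n).

Definition decay_system (u : R -> 'cV[R]_n) (t : R) (x : 'cV[R]_n) :=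
  H x - m *: x + u t.

Lemma solution_voc u (t0 b : R) x i :
  (@lebesgue_measure R).-integrable `[t0, b] (EFin \o (fun s => u s i 0)) ->
  solution (decay_system u) t0 x ->
  forall t, t0 <= t -> t <= b ->
    (@lebesgue_measure R).-integrable `[t0, b]
      (EFin \o (fun s => H (x s) i 0 + u s i 0)) /\
    x t i 0 = voc (- m) t0 (x t0 i 0) (fun s => H (x s) i 0 + u s i 0) t.
Proof.
move=> ui xs t t0t tb.
have hi : (@lebesgue_measure R).-integrable `[t0, b]
    (EFin \o (fun s => H (x s) i 0 + u s i 0)).
  apply: Rintegrable_add => //; apply: continuous_itv_integrable.
  apply: (@within_continuous_coord _ _ _ (H \o x)).
  apply: continuous_within_comp => //; exact: solution_continuous xs.
split=> //; apply: (@voc_unique _ (- m) t0 b _ hi (fun t => x t i 0)) => //.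
  by apply: within_continuous_coord; exact: solution_continuous xs.
move=> s ts sb; rewrite (xs s ts i).2; congr (_ + _).
by apply: eq_Rintegral => r _; rewrite !mxE; ring.
Qed.

Context (N : 'cV[R]_n -> R) (k : R).
Hypothesis dualN : dual_norm N.
Hypothesis mN : measurable_norm N.
Hypothesis k_ge0 : 0 <= k.
Hypothesis H_lip : forall x y : 'cV[R]_n, N (H x - H y) <= k * N (x - y).

(** Because the kernel e^(-m(t-s)) is non-negative it passes through [N], so the Lipschitz bound on
    [H] yields the integral inequality of [voc_comparison] with beta = N(u - u'). *)
Lemma decay_system_incremental u (u' : R -> 'cV[R]_n) (t0 : R) x y (t : R) : t0 <= t ->
  (forall i, (@lebesgue_measure R).-integrable `[t0, t]
    (EFin \o (fun s => u s i 0))) ->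
  (forall i, (@lebesgue_measure R).-integrable `[t0, t]
    (EFin \o (fun s => u' s i 0))) ->
  solution (decay_system u) t0 x -> solution (decay_system u') t0 y ->
  N (x t - y t) <=
    voc (k - m) t0 (N (x t0 - y t0)) (fun s => N (u s - u' s)) t.
Proof.
move=> t0t ui ui' xs ys.
have cx := @solution_continuous _ _ _ t0 t _ xs.
have cy := @solution_continuous _ _ _ t0 t _ ys.
have cphi : {within `[t0, t], continuous (fun s => N (x s - y s))}.
  apply: (@continuous_within_comp _ _ _ _ (fun s => x s - y s) N).
    exact: dual_norm_continuous.
  by move=> s; apply: cvgB; [exact: cx|exact: cy].
have ib : (@lebesgue_measure R).-integrable `[t0, t]
    (EFin \o (fun s => N (u s - u' s))).
  apply: dual_norm_integrable => // i.
  rewrite (_ : EFin \o _ = EFin \o (fun s => u s i 0 - u' s i 0)).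
    exact: Rintegrable_sub.
  by apply/funext => s; rewrite /= !mxE.
apply: (@voc_comparison _ m k t0 t _ (fun s => N (x s - y s))) => // r t0r rt.
have mD : measurable (`[t0, r]%classic : set (measurableTypeR R)) by [].
pose d s := (H (x s) + u s) - (H (y s) + u' s).
have di i : (@lebesgue_measure R).-integrable `[t0, r]
    (EFin \o (fun s => expR (- m * (r - s)) * d s i 0)).
  apply: (voc_integrable _ rt).
  rewrite (_ : EFin \o _ = EFin \o (fun s => (H (x s) i 0 + u s i 0) -
    (H (y s) i 0 + u' s i 0))); last by apply/funext => s; rewrite /= !mxE.
  apply: Rintegrable_sub => //.
    exact: (solution_voc (ui i) xs t0r rt).1.
  exact: (solution_voc (ui' i) ys t0r rt).1.
have -> : x r - y r = expR (- m * (r - t0)) *: (x t0 - y t0) +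
    \col_i \int[@lebesgue_measure R]_(s in `[t0, r])
      ((expR (- m * (r - s)) *: d s) i 0).
  apply/colP => i; rewrite !mxE.
  have [xi ->] := solution_voc (ui i) xs t0r rt.
  have [yi ->] := solution_voc (ui' i) ys t0r rt.
  rewrite /voc opprD addrACA -mulrBr -RintegralB//; last 2 first.
  - exact: voc_integrable xi.
  - exact: voc_integrable yi.
  by congr (_ + _); apply: eq_Rintegral => s _; rewrite -mulrBr !mxE.
apply: le_trans (dual_norm_triangle dualN _ _) _.
rewrite dual_normZ// ger0_norm ?expR_ge0// lerD2l.
have gi i : (@lebesgue_measure R).-integrable `[t0, r]
    (EFin \o (fun s => (expR (- m * (r - s)) *: d s) i 0)).
  rewrite (_ : EFin \o _ = EFin \o (fun s => expR (- m * (r - s)) * d s i 0)) //.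
  by apply/funext => s; rewrite /= mxE.
apply: le_trans (dual_norm_Rintegral dualN mN mD gi) _.
apply: le_Rintegral => //.
- exact: dual_norm_integrable.
- apply: (voc_integrable _ rt); apply: Rintegrable_add => //.
  apply: Rintegrable_scale => //; exact: continuous_itv_integrable.
move=> s _; rewrite dual_normZ// ger0_norm ?expR_ge0// ler_wpM2l ?expR_ge0//.
rewrite /d opprD addrACA; apply: le_trans (dual_norm_triangle dualN _ _) _.
by rewrite lerD2r.
Qed.

(* [voc_comparison] is applied to the [v]-weighted sum of the positive parts of
   the entries of x - y. *)
Lemma decay_system_monotone (v : 'I_n -> R) (kv : R) u (t0 : R) x y (t : R) :
  (forall i, 0 < v i) -> 0 <= kv ->
  (forall a b : 'cV[R]_n, \sum_i v i * Num.max ((H a - H b) i 0) 0 <=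
    kv * \sum_i v i * Num.max ((a - b) i 0) 0) ->
  t0 <= t ->
  (forall i, (@lebesgue_measure R).-integrable `[t0, t]
    (EFin \o (fun s => u s i 0))) ->
  solution (decay_system u) t0 x -> solution (decay_system u) t0 y ->
  vle (x t0) (y t0) -> vle (x t) (y t).
Proof.
move=> v0 kv0 Hv t0t ui xs ys xy0.
have cx := @solution_continuous _ _ _ t0 t _ xs.
have cy := @solution_continuous _ _ _ t0 t _ ys.
have cpos (a b : R -> 'cV[R]_n) i : {within `[t0, t], continuous a} ->
    {within `[t0, t], continuous b} ->
    {within `[t0, t], continuous (fun s => Num.max ((a s - b s) i 0) 0)}.
  move=> ca cb.
  apply: (@continuous_within_comp _ _ _ _ (fun s => (a s - b s) i 0)
    (fun r : R => Num.max r 0)).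
    move=> r; apply: (@continuous_max _ _ id (cst 0)) => //; exact: cvg_cst.
  apply: (@within_continuous_coord _ _ _ (fun s => a s - b s)) => r.
  by apply: cvgB; [exact: ca|exact: cb].
pose D s := \sum_i v i * Num.max ((x s - y s) i 0) 0.
have cD : {within `[t0, t], continuous D}.
  move=> s; apply: cvg_big => [|i _]; first exact: add_continuous.
  by apply: cvgM; [exact: cvg_cst|exact: cpos].
have cHx : {within `[t0, t], continuous (H \o x)} by exact: continuous_within_comp.
have cHy : {within `[t0, t], continuous (H \o y)} by exact: continuous_within_comp.
have D0 : D t <= 0.
  have -> : 0 = voc (kv - m) t0 0 (fun=> 0) t.
    rewrite /voc mulr0 add0r; under eq_Rintegral do rewrite mulr0.
    by rewrite Rintegral_cst// mul0r.
  apply: (@voc_comparison _ m kv t0 t _ D) => //.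
    exact: integrable0.
  move=> r t0r rt.
  have pi i : (@lebesgue_measure R).-integrable `[t0, r] (EFin \o
      (fun s => expR (- m * (r - s)) * Num.max ((H (x s) - H (y s)) i 0) 0)).
    apply: (voc_integrable _ rt); apply: continuous_itv_integrable.
    exact: (cpos (H \o x) (H \o y)).
  rewrite /voc mulr0 add0r.
  apply: (@le_trans _ _ (\sum_i v i * \int[@lebesgue_measure R]_(s in `[t0, r])
      (expR (- m * (r - s)) * Num.max ((H (x s) - H (y s)) i 0) 0))).
    apply: ler_sum => i _; rewrite ler_wpM2l ?(ltW (v0 _))// ge_max.
    apply/andP; split; last first.
      by apply: Rintegral_ge0 => s _; rewrite mulr_ge0 ?expR_ge0// le_max lexx orbT.
    have [xi xE] := solution_voc (ui i) xs t0r rt.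
    have [yi yE] := solution_voc (ui i) ys t0r rt.
    rewrite !mxE xE yE /voc opprD addrACA -mulrBr -RintegralB//; last 2 first.
    - exact: voc_integrable xi.
    - exact: voc_integrable yi.
    (* The initial difference is non-positive and is dropped; the common input cancels, leaving H(x)
       - H(y), which is at most its positive part. *)
    rewrite ler_wnDl// ?mulr_ge0_le0 ?expR_ge0 ?subr_le0//.
    apply: le_Rintegral => //.
      by apply: Rintegrable_sub => //; [exact: voc_integrable xi|exact: voc_integrable yi].
    move=> s _; rewrite -mulrBr ler_wpM2l ?expR_ge0// le_max !mxE.
    by rewrite opprD addrACA subrr addr0 lexx.
  under eq_bigr do rewrite -RintegralZl//.
  rewrite -Rintegral_sum//; last by move=> i; exact: Rintegrable_scale.
  apply: le_Rintegral => //.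
  - by apply: Rintegrable_sum => // i; exact: Rintegrable_scale.
  - apply: (voc_integrable _ rt); apply: continuous_itv_integrable.
    by move=> s; apply: cvgD; [apply: cvgM; [exact: cvg_cst|exact: cD]|exact: cvg_cst].
  move=> s _; rewrite addr0; under eq_bigr do rewrite mulrCA.
  by rewrite -mulr_sumr ler_wpM2l ?expR_ge0.
move=> i; rewrite -subr_le0.
have Dge j : 0 <= v j * Num.max ((x t - y t) j 0) 0.
  by rewrite mulr_ge0 ?(ltW (v0 _))// le_max lexx orbT.
have /eqP : D t = 0 by apply/eqP; rewrite eq_le D0 sumr_ge0.
rewrite psumr_eq0// => /allP/(_ i); rewrite mem_index_enum => /(_ isT).
rewrite /= mulf_eq0 gt_eqF//= => /eqP Hi0.
by have : (x t - y t) i 0 <= 0; [rewrite -[leRHS]Hi0 le_max lexx|rewrite !mxE].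
Qed.
End DecaySystem.

(** * Existence of solutions *)

Lemma cvg_mul_half (R : realType) (C e : R) : 0 < e ->
  \forall k \near \oo, C * 2^-1 ^+ k < e.
Proof.
move=> e0; have := @cvg_geometric R C 2^-1 _.
rewrite ger0_norm// invf_lt1// ltr1n => /(_ isT)/cvgr0Pnorm_lt/(_ e e0).
by apply: filterS => k; apply: le_lt_trans; rewrite /geometric/= ler_norm.
Qed.

(** The limit is the supremum of the lower bounds a_j - 2 C 2^(-j). Each of them lies below every
    upper bound a_k + 2 C 2^(-k), so the error estimate is available before convergence, and
    convergence follows from it. The 2 is the sum of the series of 2^(-k). *)
Lemma limn_geometric (R : realType) (a : nat -> R) (C : R) :
  (forall k, `|a k.+1 - a k| <= C * 2^-1 ^+ k) ->
  forall k, `|limn a - a k| <= 2 * C * 2^-1 ^+ k.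
Proof.
move=> aC.
have C0 : 0 <= C by have := aC 0; rewrite expr0 mulr1; exact: le_trans.
have half0 k : 0 <= 2^-1 ^+ k :> R by rewrite exprn_ge0// invr_ge0.
(* The factor 1 - 2^(-p) records the partial sum of the series and makes the two terms of the
   induction step add up exactly. *)
have aCp k p : `|a (k + p)%N - a k| <= 2 * C * 2^-1 ^+ k * (1 - 2^-1 ^+ p).
  elim: p => [|p IH]; first by rewrite addn0 subrr normr0 expr0 subrr mulr0.
  rewrite addnS; apply: (@le_trans _ _ (C * 2^-1 ^+ (k + p) +
      2 * C * 2^-1 ^+ k * (1 - 2^-1 ^+ p))).
    by rewrite -[a (k + p).+1](subrK (a (k + p)%N)) -addrA (le_trans (ler_normD _ _))// lerD.
  by rewrite exprD exprS le_eqVlt; apply/orP; left; apply/eqP; field.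
have {}aCp k p : `|a (k + p)%N - a k| <= 2 * C * 2^-1 ^+ k.
  apply: le_trans (aCp k p) _; rewrite ler_piMr// ?lerBlDr ?lerDl//.
  by rewrite !mulr_ge0.
pose b j := a j - 2 * C * 2^-1 ^+ j.
have bk j k : b j <= a k + 2 * C * 2^-1 ^+ k.
  rewrite /b; have [/subnKC kj|/ltnW/subnKC jk] := leqP k j.
    have := aCp k (j - k)%N; rewrite kj ler_norml => /andP[_].
    have := half0 j; have : 0 <= 2 * C by rewrite mulr_ge0. nra.
  have := aCp j (k - j)%N; rewrite jk ler_norml => /andP[+ _].
  have := half0 k; have : 0 <= 2 * C by rewrite mulr_ge0. nra.
pose l := sup (range b).
have lC k : `|l - a k| <= 2 * C * 2^-1 ^+ k.
  rewrite ler_distl; apply/andP; split.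
    apply: ub_le_sup; last by exists k.
    by exists (a 0%N + 2 * C * 2^-1 ^+ 0) => _ [j _ <-].
  apply: ge_sup; first by exists (b 0%N); exists 0%N.
  by move=> _ [j _ <-].
have -> // : limn a = l.
apply: cvg_lim => //; apply/cvgrPdist_lt => e e0.
by apply: filterS (cvg_mul_half (2 * C) e0) => k; exact: le_lt_trans.
Qed.

Lemma within_continuous_geometric_limit (R : realType) (A : set R)
    (f : nat -> R -> R) (g : R -> R) (C : R) :
  (forall k, {within A, continuous f k}) ->
  (forall k s, A s -> `|g s - f k s| <= C * 2^-1 ^+ k) ->
  {within A, continuous g}.
Proof.
move=> cf fg.
apply: (@uniform_limit_continuous_subspace _ _ A (f @ \oo) g).
  by exists 0%N => // k _; exact: cf.
move=> P /uniform_nbhs[E [/= + EP]]; rewrite -entourage_ballE => -[e e0 eE].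
have := cvg_mul_half C e0; apply: filterS => k ke; apply: EP => s As.
by apply: eE => /=; rewrite /ball/=; apply: le_lt_trans ke; exact: fg.
Qed.

Lemma cV_norm_le (R : realType) (n : nat) (x : 'cV[R]_n) (c : R) : 0 <= c ->
  (forall i, `|x i 0| <= c) -> `|x| <= c.
Proof.
move=> c0 xc; rewrite [leLHS]mx_normrE; apply/bigmax_leP.
by split=> // -[i j] _; rewrite (ord1 j).
Qed.

Lemma le_cV_norm (R : realType) (n : nat) (x : 'cV[R]_n) i : `|x i 0| <= `|x|.
Proof.
rewrite [leRHS]mx_normrE.
exact: (le_bigmax 0 (fun i => `|x i.1 i.2|) (i, 0)).
Qed.

Lemma lipschitz_cV_continuous (R : realType) (n : nat) (A : 'cV[R]_n -> 'cV[R]_n)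
    (L : R) : 0 < L ->
  (forall x y, `|A x - A y| <= L * `|x - y|) -> continuous A.
Proof.
move=> L0 AL x; apply/(@cvgrPdist_le _ _ _ _ (nbhs_filter x)) => e e0; near=> y.
apply: le_trans (AL x y) _; rewrite mulrC -ler_pdivlMr//; near: y.
by apply: (@cvgr_dist_le _ _ _ _ (nbhs_filter x) id x) => //; exact: divr_gt0.
Unshelve. all: by end_near. Qed.

Section Picard.
Context (R : realType) (n : nat) (A : 'cV[R]_n -> 'cV[R]_n) (L : R).
Hypothesis L_gt0 : 0 < L.
Hypothesis A_lip : forall x y, `|A x - A y| <= L * `|x - y|.
Context (u : R -> 'cV[R]_n) (t0 : R) (x0 : 'cV[R]_n).
Hypothesis ui : forall t, t0 <= t -> forall i,
  (@lebesgue_measure R).-integrable `[t0, t] (EFin \o (fun s => u s i 0)).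

Let rhs (x : R -> 'cV[R]_n) s i := A (x s) i 0 + u s i 0.

Let Phi (x : R -> 'cV[R]_n) t : 'cV[R]_n :=
  x0 + \col_i \int[@lebesgue_measure R]_(s in `[t0, t]) rhs x s i.

Let X k := iter k Phi (fun=> x0).

Let rhs_int x T i : t0 <= T -> {within `[t0, T], continuous x} ->
  (@lebesgue_measure R).-integrable `[t0, T] (EFin \o (fun s => rhs x s i)).
Proof.
move=> t0T cx; apply: Rintegrable_add => //; last exact: ui.
apply: continuous_itv_integrable.
apply: (@within_continuous_coord _ _ _ (A \o x)).
apply: continuous_within_comp => //; exact: lipschitz_cV_continuous A_lip.
Qed.

Let X_cont k T : t0 <= T -> {within `[t0, T], continuous (X k)}.
Proof.
move=> t0T; elim: k => [|k IH] /=; first by move=> t; exact: cvg_cst.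
apply: cV_within_continuous => i.
rewrite (_ : (fun t => _) = (fun t => x0 i 0 +
    \int[lebesgue_measure]_(s in `[t0, t]) rhs (X k) s i)); last first.
  by apply/funext => t; rewrite !mxE.
move=> t; apply: cvgD; first exact: cvg_cst.
by apply: (@parameterized_integral_continuous _ t0 T) => //; exact: rhs_int.
Qed.

(** Weight of a Bielecki norm: the integral of L E from [t0] is at most E / 2, whence the exponent 2
    L, and the iteration converges on every bounded interval at once. *)
Let E (t : R) := expR (2 * L * t).

Let E_int t a : (@lebesgue_measure R).-integrable `[t0, t]
  (EFin \o (fun s => a * E s)).
Proof.
apply: continuous_itv_integrable; apply: continuous_subspaceT => s.
by apply: cvgM; [exact: cvg_cst|exact: continuous_expR_scale].
Qed.

Let A_coord x y i : `|A x i 0 - A y i 0| <= L * `|x - y|.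
Proof.
apply: le_trans (A_lip x y); apply: le_trans (le_cV_norm _ i).
by rewrite !mxE.
Qed.

(* The weight [E] makes [Phi] a contraction of ratio 1/2. *)
Let Phi_contract x y T C t : 0 <= C -> t0 <= t -> t <= T ->
  {within `[t0, T], continuous x} -> {within `[t0, T], continuous y} ->
  (forall s, t0 <= s -> s <= T -> `|x s - y s| <= C * E s) ->
  `|Phi x t - Phi y t| <= C / 2 * E t.
Proof.
move=> C0 t0t tT cx cy xy.
have t0T := le_trans t0t tT.
apply: cV_norm_le => [|i]; first by rewrite mulr_ge0 ?expR_ge0 ?divr_ge0.
have xi : (@lebesgue_measure R).-integrable `[t0, t] (EFin \o (fun s => rhs x s i)).
  exact: integrable_itvS (rhs_int i t0T cx) _ _.
have yi : (@lebesgue_measure R).-integrable `[t0, t] (EFin \o (fun s => rhs y s i)).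
  exact: integrable_itvS (rhs_int i t0T cy) _ _.
rewrite !mxE opprD addrACA subrr add0r -RintegralB//.
have mD : measurable (`[t0, t]%classic : set (measurableTypeR R)) by [].
have di := Rintegrable_sub mD xi yi.
apply: le_trans (le_normr_Rintegral _ _) _ => //.
apply: (@le_trans _ _ (\int[@lebesgue_measure R]_(s in `[t0, t])
    (C / 2 * (2 * L * E s)))).
  apply: le_Rintegral => //.
  - exact: integrable_norm.
  - rewrite (_ : EFin \o _ = EFin \o (fun s => (C / 2 * (2 * L)) * E s)) //.
    by apply/funext => s; rewrite /= mulrA.
  move=> s /=; rewrite in_itv/= => /andP[t0s st].
  rewrite /rhs opprD addrACA subrr addr0; apply: le_trans (A_coord _ _ _) _.
  rewrite [leRHS](_ : _ = L * (C * E s)); last by field.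
  by rewrite ler_wpM2l ?(ltW L_gt0)// xy// (le_trans st).
rewrite (RintegralZl _ mD (E_int t (2 * L))) /E Rintegral_expR// ler_wpM2l ?divr_ge0//.
by rewrite gerBl expR_ge0.
Qed.

Let E_mono s t : s <= t -> E s <= E t.
Proof. by move=> st; rewrite ler_expR ler_wpM2l// mulr_ge0// ltW. Qed.

Let X_geometric T : t0 <= T -> exists2 B, 0 <= B & forall k t, t0 <= t -> t <= T ->
  `|X k.+1 t - X k t| <= B * 2^-1 ^+ k * E t.
Proof.
move=> t0T.
have cd : {within `[t0, T], continuous (fun t => `|X 1 t - X 0 t|)}.
  move=> t; apply: cvg_norm.
  by apply: cvgB; [exact: (@X_cont 1 T)|exact: (@X_cont 0 T)].
have [c _ cM] := EVT_max t0T cd.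
have Et0 : 0 < E t0 by exact: expR_gt0.
(* The first step is bounded by its maximum on [t0, T]; [E t0] is the least value of the weight
   there. *)
exists (`|X 1 c - X 0 c| / E t0) => [|k]; first by rewrite divr_ge0// ltW.
elim: k => [|k IH] t t0t tT.
  rewrite expr0 mulr1; apply: (@le_trans _ _ `|X 1 c - X 0 c|).
    by apply: cM; rewrite in_itv/= t0t.
  by rewrite mulrAC ler_pdivlMr// ler_wpM2l// E_mono.
rewrite exprSr mulrA.
apply: (@Phi_contract (X k.+1) (X k) T) => //.
- by rewrite mulr_ge0 ?exprn_ge0 ?invr_ge0// divr_ge0// ltW.
- exact: X_cont.
- exact: X_cont.
Qed.

(** The limit is taken pointwise, so one curve serves all horizons [T]; only the constants in
    [Xlim_bound] depend on [T]. *)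
Let Xlim t : 'cV[R]_n := \col_i limn (fun k => X k t i 0).

Let Xlim_bound T : t0 <= T -> exists2 C, 0 <= C & forall k t, t0 <= t -> t <= T ->
  `|Xlim t - X k t| <= C * 2^-1 ^+ k.
Proof.
move=> t0T; have [B B0 XB] := X_geometric t0T.
exists (2 * (B * E T)) => [|k t t0t tT].
  by rewrite !mulr_ge0// expR_ge0.
apply: cV_norm_le => [|i].
  by rewrite !mulr_ge0 ?exprn_ge0 ?invr_ge0// expR_ge0.
rewrite !mxE; apply: limn_geometric => {}k.
rewrite (le_trans _ (_ : B * 2^-1 ^+ k * E t <= _))//; last first.
  by rewrite mulrAC ler_wpM2r ?exprn_ge0 ?invr_ge0// ler_wpM2l// E_mono.
apply: le_trans (XB k t t0t tT); apply: le_trans (le_cV_norm _ i).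
by rewrite !mxE.
Qed.

Let Xlim_cont T : t0 <= T -> {within `[t0, T], continuous Xlim}.
Proof.
move=> t0T; have [C C0 XC] := Xlim_bound t0T.
apply: cV_within_continuous => i.
apply: (@within_continuous_geometric_limit _ _ (fun k t => X k t i 0) _ C) => [k|k t /=].
  by apply: within_continuous_coord; exact: X_cont.
rewrite in_itv/= => /andP[t0t tT].
apply: le_trans (XC k t t0t tT); apply: le_trans (le_cV_norm _ i).
by rewrite !mxE.
Qed.

(** The iterate [X k.+1] is close to [Xlim] by [Xlim_bound] and, being [Phi (X k)], close to
    [Phi Xlim] by [Phi_contract]; [K] collects the two errors. *)
Let Xlim_fixed t : t0 <= t -> Xlim t = Phi Xlim t.
Proof.
move=> t0t; have [C C0 XC] := Xlim_bound t0t.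
have Et0 : 0 < E t0 by exact: expR_gt0.
pose K := C + C / E t0 / 2 * E t.
have XK k : `|Xlim t - Phi Xlim t| <= K * 2^-1 ^+ k.
  rewrite -[X in `|X|](subrKA (X k.+1 t)); apply: le_trans (ler_normD _ _) _.
  rewrite /K mulrDl lerD//.
    apply: le_trans (XC k.+1 t t0t (lexx t)) _; rewrite ler_wpM2l//.
    by rewrite exprS ler_piMl ?exprn_ge0 ?invr_ge0// invf_le1// ler1n.
  rewrite [leRHS](_ : _ = C * 2^-1 ^+ k / E t0 / 2 * E t); last first.
    by field; rewrite gt_eqF.
  apply: (@Phi_contract (X k) Xlim t) => //.
  - by rewrite divr_ge0 ?mulr_ge0 ?exprn_ge0 ?invr_ge0// ltW.
  - exact: X_cont.
  - exact: Xlim_cont.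
  move=> s t0s st; rewrite distrC; apply: le_trans (XC k s t0s st) _.
  rewrite mulrAC ler_pdivlMr// ler_wpM2l ?E_mono//.
  by rewrite mulr_ge0 ?exprn_ge0 ?invr_ge0.
apply/eqP; rewrite -subr_eq0 -normr_le0; apply/ler_addgt0Pl => e e0.
have [k _ /(_ k (leqnn k)) ke] := cvg_mul_half K e0.
by rewrite addr0 (le_trans (XK k))// ltW.
Qed.

Lemma picard_existence : exists x,
  x t0 = x0 /\ solution (fun t x => A x + u t) t0 x.
Proof.
exists Xlim; have Xt0 : Xlim t0 = x0.
  rewrite Xlim_fixed//; apply/colP => i; rewrite !mxE.
  by rewrite set_itv1 Rintegral_set1 addr0.
split=> // t t0t i.
have E1 : (fun s => (A (Xlim s) + u s) i 0) = (fun s => rhs Xlim s i).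
  by apply/funext => s; rewrite mxE.
rewrite E1 Xt0; split; first by apply: rhs_int => //; exact: Xlim_cont.
by rewrite Xlim_fixed// !mxE.
Qed.
End Picard.

(** * Autonomous systems *)

Lemma cVD (R : realType) (n : nat) (x y : 'cV[R]_n) i :
  (x + y) i 0 = x i 0 + y i 0.
Proof. by rewrite mxE. Qed.

Lemma cVB (R : realType) (n : nat) (x y : 'cV[R]_n) i :
  (x - y) i 0 = x i 0 - y i 0.
Proof. by rewrite !mxE. Qed.

Lemma cVZ (R : realType) (n : nat) a (x : 'cV[R]_n) i :
  (a *: x) i 0 = a * x i 0.
Proof. by rewrite mxE. Qed.

Lemma Rintegral_shift (R : realType) (f : R -> R) (a b h : R) : a <= b ->
  {within `[a + h, b + h], continuous f} ->
  \int[@lebesgue_measure R]_(s in `[a + h, b + h]) f s =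
  \int[@lebesgue_measure R]_(s in `[a, b]) f (s + h).
Proof.
move=> ab cf; rewrite /Rintegral.
have dF (x : R) : is_derive x 1 (fun s : R => s + h) 1.
  have := @is_deriveD _ _ _ id (cst h) x 1 1 0 (is_derive_id _ _) (is_derive_cst _ _ _).
  by rewrite addr0; exact.
have dE : derive1 (fun s : R => s + h) = cst 1.
  by apply/funext => s; rewrite derive1E; have [_ ->] := dF s.
have cs : continuous (fun s : R => s + h).
  by move=> s; apply: cvgD; [exact: cvg_id|exact: cvg_cst].
rewrite (@integration_by_substitution_increasing _ (fun s => s + h))//.
- congr fine; apply: eq_integral => s _; rewrite dE.
  by congr EFin; rewrite /= mulr1.
- by move=> x y _ _ xy; rewrite ltrD2r.
- by rewrite dE => s _; exact: cvg_cst.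
- by rewrite dE; exact: is_cvg_cst.
- by rewrite dE; exact: is_cvg_cst.
- split=> [s _||]; first by have [] := dF s.
    by apply: cvg_at_right_filter; exact: cs.
  by apply: cvg_at_left_filter; exact: cs.
Qed.

Lemma within_continuous_shift (R : realType) (U : topologicalType) (f : R -> U)
    (a b h : R) : {within `[a + h, b + h], continuous f} ->
  {within `[a, b], continuous (fun s => f (s + h))}.
Proof.
move=> /subspace_continuousP cf; apply/subspace_continuousP => s.
rewrite /= in_itv/= => /andP[as_ sb].
have /cf fsh : `[a + h, b + h]%classic (s + h) by rewrite /= in_itv/= !lerD2r as_.
move=> P /fsh Psh.
have cs : (s' + h) @[s' --> s] --> s + h.
  by apply: cvgD; [exact: cvg_id|exact: cvg_cst].
apply: (@filterS _ (nbhs s) _ _ _ _ (cs _ Psh)) => r /= Pr; rewrite in_itv/= => rab.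
by apply: Pr; rewrite in_itv/= !lerD2r.
Qed.

Lemma Rintegral_itv_split (R : realType) (f : R -> R) (a b c : R) :
  a <= b -> b <= c ->
  (@lebesgue_measure R).-integrable `[a, c] (EFin \o f) ->
  \int[@lebesgue_measure R]_(s in `[a, c]) f s =
  \int[@lebesgue_measure R]_(s in `[a, b]) f s +
  \int[@lebesgue_measure R]_(s in `[b, c]) f s.
Proof.
move=> ab bc fi; have := @Rintegral_itvB _ f (BLeft a) (BRight c) b fi.
rewrite !bnd_simp => /(_ ab bc) /eqP; rewrite subr_eq => /eqP ->.
rewrite addrC Rintegral_itv_obnd_cbnd//.
by apply: integrableS fi => //; apply: subset_itv; rewrite bnd_simp.
Qed.

Lemma solution_restart (R : realType) (n : nat)
    (f : R -> 'cV[R]_n -> 'cV[R]_n) (t0 s : R) (x : R -> 'cV[R]_n) :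
  t0 <= s -> solution f t0 x -> solution f s x.
Proof.
move=> t0s xs t st i; have t0t := le_trans t0s st.
have [fi xt] := xs t t0t i; split; first exact: integrable_itvS fi _ _.
by rewrite xt (xs s t0s i).2 (Rintegral_itv_split t0s st fi) addrA.
Qed.

Lemma continuous_subr (R : realType) (n : nat) (F : 'cV[R]_n -> 'cV[R]_n)
    (a : 'cV[R]_n) : continuous F -> continuous (fun z => F z - a).
Proof.
move=> cF z; apply: (@continuousB _ _ _ F (cst a)); first exact: cF.
exact: cst_continuous.
Qed.

Lemma dual_norm_comp_continuous (R : realType) (n : nat) (N : 'cV[R]_n -> R)
    (F : 'cV[R]_n -> 'cV[R]_n) :
  dual_norm N -> continuous F -> continuous (fun z => N (F z)).
Proof.
move=> dualN cF z; apply: continuous_comp; first exact: cF.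
exact: dual_norm_continuous.
Qed.

Section Autonomous.
Context (R : realType) (n : nat) (F : 'cV[R]_n -> 'cV[R]_n).
Hypothesis cF : continuous F.

Lemma autonomous_within_continuous (s T : R) (x : R -> 'cV[R]_n) i :
  solution (fun=> F) s x -> {within `[s, T], continuous (fun t => F (x t) i 0)}.
Proof.
move=> xs; apply: (@within_continuous_coord _ _ _ (F \o x)).
by apply: continuous_within_comp => //; exact: solution_continuous xs.
Qed.

Lemma solution_shift (s h : R) (x : R -> 'cV[R]_n) : 0 <= h ->
  solution (fun=> F) s x -> solution (fun=> F) s (fun t => x (t + h)).
Proof.
move=> h0 xs t st i.
have xh : solution (fun=> F) (s + h) x by apply: solution_restart xs; rewrite lerDl.
have cf := @autonomous_within_continuous (s + h) (t + h) x i xh.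
split.
  apply: continuous_itv_integrable.
  exact: (@within_continuous_shift _ _ (fun r => F (x r) i 0)).
by rewrite (xh (t + h) _ i).2 ?lerD2r// (Rintegral_shift st cf).
Qed.

Context (N : 'cV[R]_n -> R).
Hypothesis dualN : dual_norm N.
Hypothesis mN : measurable_norm N.

(** The error is the integral of F(x(t)) - F(x(r)) over [r, r + h], and continuity of the field
    along the trajectory makes the integrand small near [r]. The derivative is one-sided because a
    solution is constrained only from [s] on. *)
Lemma solution_right_derivative (s r e : R) (x : R -> 'cV[R]_n) :
  s <= r -> 0 < e -> solution (fun=> F) s x ->
  exists2 d, 0 < d & forall h, 0 < h -> h < d ->
    N (x (r + h) - x r - h *: F (x r)) <= e * h.
Proof.
move=> sr e0 xs; have xr := solution_restart sr xs.
pose phi t := N (F (x t) - F (x r)).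
have cphi : {within `[r, r + 1], continuous phi}.
  apply: (@continuous_within_comp _ _ _ _ (fun t => x t) (fun z => N (F z - F (x r)))).
    by apply: dual_norm_comp_continuous => //; exact: continuous_subr.
  exact: solution_continuous xr.
have r1 : r < r + 1 by rewrite ltrDl.
have [_ phir _] := (continuous_within_itvP phi r1).1 cphi.
have : \forall t \near r^'+, phi t < e.
  apply: (cvgr_lt (phi r)) => //.
  by rewrite /phi subrr dual_norm0.
move=> [d /= d0 dphi]; exists d => // h h0 hd.
have fi i : (@lebesgue_measure R).-integrable `[r, r + h]
    (EFin \o (fun t => (F (x t) - F (x r)) i 0)).
  apply: continuous_itv_integrable.
  apply: (@within_continuous_coord _ _ _ (fun t => F (x t) - F (x r))).
  apply: (@continuous_within_comp _ _ _ _ x (fun z => F z - F (x r))).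
    exact: continuous_subr.
  exact: solution_continuous xr.
have mD : measurable (`[r, r + h]%classic : set (measurableTypeR R)) by [].
have muD : fine (@lebesgue_measure R `[r, r + h]) = h.
  by rewrite lebesgue_measure_itv/= lte_fin ltrDl h0 /= addrAC subrr add0r.
have -> : x (r + h) - x r - h *: F (x r) =
    \col_i \int[@lebesgue_measure R]_(t in `[r, r + h]) (F (x t) - F (x r)) i 0.
  apply/colP => i; rewrite [RHS]mxE !cVB cVZ.
  under eq_Rintegral do rewrite cVB.
  rewrite RintegralB//; last 2 first.
  - apply: continuous_itv_integrable; exact: autonomous_within_continuous xr.
  - by apply: continuous_itv_integrable => t; exact: cvg_cst.
  rewrite Rintegral_cst// muD (xr (r + h) _ i).2 ?lerDl ?(ltW h0)//.
  by rewrite [x r i 0 + _]addrC addrK [h * _]mulrC.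
apply: le_trans (dual_norm_Rintegral dualN mN mD fi) _.
rewrite -[X in e * X]muD -Rintegral_cst//; apply: le_Rintegral => //.
- exact: dual_norm_integrable.
- by apply: continuous_itv_integrable => t; exact: cvg_cst.
move=> t /=; rewrite in_itv/= le_eqVlt => /andP[/predU1P[<-|rt] trh].
  by rewrite subrr dual_norm0// ltW.
apply/ltW/dphi => //=; rewrite ltr0_norm ?subr_lt0// opprB.
by rewrite ltrBlDl (le_lt_trans trh)// ltrD2l.
Qed.

(* Compare the trajectory with its own shift by [h] and let [h] tend to 0. *)
Lemma contraction_vector_field_decay (c s t : R) (x : R -> 'cV[R]_n) :
  (forall y z, solution (fun=> F) s y -> solution (fun=> F) s z ->
    N (y t - z t) <= expR (- c * (t - s)) * N (y s - z s)) ->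
  s <= t -> solution (fun=> F) s x ->
  N (F (x t)) <= expR (- c * (t - s)) * N (F (x s)).
Proof.
move=> contr st xs; set q := expR _; have q0 : 0 <= q by exact: expR_ge0.
apply/ler_addgt0Pl => e e0.
(* The increment quotient is compared with the field once at [t] and once at [s], the latter error
   being multiplied by [q]; this choice makes the total [e]. *)
have e1 : 0 < e / (1 + q) by rewrite divr_gt0// ltr_wpDr.
have [d1 d10 H1] := solution_right_derivative st e1 xs.
have [d2 d20 H2] := solution_right_derivative (lexx s) e1 xs.
pose h := Num.min d1 d2 / 2.
have m0 : 0 < Num.min d1 d2 by rewrite lt_min d10.
have h0 : 0 < h by rewrite divr_gt0.
have hm : h < Num.min d1 d2 by rewrite ltr_pdivrMr// ltr_pMr// ltr1n.
have /andP[hd1 hd2] : (h < d1) && (h < d2) by rewrite -lt_min.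
have {}H1 := H1 h h0 hd1; have {}H2 := H2 h h0 hd2.
have := contr _ _ (solution_shift (ltW h0) xs) xs.
rewrite -/q => xh.
have NF r : h * N (F (x r)) = N (h *: F (x r)) by rewrite dual_normZ// gtr0_norm.
have A1 : h * N (F (x t)) <= e / (1 + q) * h + N (x (t + h) - x t).
  rewrite NF -[h *: _](subrK (x (t + h) - x t)).
  by apply: le_trans (dual_norm_triangle dualN _ _) _; rewrite lerD2r dual_norm_distC.
have A2 : N (x (s + h) - x s) <= e / (1 + q) * h + h * N (F (x s)).
  rewrite NF -[x (s + h) - x s](subrK (h *: F (x s))).
  by apply: le_trans (dual_norm_triangle dualN _ _) _; rewrite lerD2r.
have A3 : h * N (F (x t)) <= h * (e + q * N (F (x s))).
  apply: le_trans A1 _; apply: le_trans (lerD (lexx _) xh) _.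
  apply: le_trans (lerD (lexx _) (ler_wpM2l q0 A2)) _.
  rewrite le_eqVlt; apply/orP; left; apply/eqP; field.
  by rewrite gt_eqF// ltr_pwDl.
by move: A3; rewrite ler_pM2l.
Qed.
End Autonomous.

(** * The Hopfield network *)

Lemma sector_norm (R : realType) (f : R -> R) (G : R) :
  (forall a b, a != b -> 0 <= (f a - f b) / (a - b) <= G) ->
  forall a b, `|f a - f b| <= G * `|a - b|.
Proof.
move=> fG a b; have [->|ab] := eqVneq a b; first by rewrite !subrr normr0 mulr0.
have /andP[q0 qG] := fG a b ab.
rewrite -ler_pdivrMr ?normr_gt0 ?subr_eq0// -normf_div.
by rewrite ger0_norm.
Qed.

(** For a < b the non-negative quotient makes f a - f b <= 0, and for a > b the upper bound
    applies. *)
Lemma sector_max0 (R : realType) (f : R -> R) (G : R) : 0 <= G ->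
  (forall a b, a != b -> 0 <= (f a - f b) / (a - b) <= G) ->
  forall a b, f a - f b <= G * Num.max (a - b) 0.
Proof.
move=> G0 fG a b; have [->|ab] := eqVneq a b.
  by rewrite !subrr mulr_ge0// le_max lexx orbT.
have /andP[q0 qG] := fG a b ab.
have ab0 : a - b != 0 by rewrite subr_eq0.
rewrite -[f a - f b](divfK ab0); have [ab1|ab1] := leP 0 (a - b).
  by rewrite ler_wpM2r.
by rewrite mulr0 mulr_ge0_le0// ltW.
Qed.

Section Hopfield.
Context (R : realType) (n : nat) (Lam T : 'M[R]_n) (g : 'I_n -> R -> R)
  (G : 'cV[R]_n) (c : R) (v w : 'cV[R]_n).
Hypothesis Lam_diag : is_diag_mx Lam.
Hypothesis T_ge0 : forall i j, 0 <= T i j.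
Hypothesis G_gt0 : forall i, 0 < G i 0.
Hypothesis g_sector : forall i a b, a != b ->
  0 <= (g i a - g i b) / (a - b) <= G i 0.
Hypothesis M_hurwitz : hurwitz (- Lam + T *m diagv G).
Hypothesis v_perron : left_perron_pair (- Lam + T *m diagv G) (- c) v.
Hypothesis w_perron : right_perron_pair (- Lam + T *m diagv G) (- c) w.

(** [hurwitz] speaks of the complex spectrum, so the real eigenvalue - c is first carried along the
    embedding into the complex numbers. *)
Lemma perron_rate_gt0 : 0 < c.
Proof.
have [[lamE _ _] _ _] := v_perron.
have /M_hurwitz : eigenvalue (complexify (- Lam + T *m diagv G))
    (real_complex R (- c)) by rewrite /complexify eigenvalue_map.
by rewrite /= oppr_lt0.
Qed.

(* Shifting by [hop_m] makes both the field and its comparison matrix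
   [hop_B = hop_m + (- Lam + T [G])] order preserving. *)
Definition hop_m := c + \sum_i `|Lam i i|.
Definition hop_k := hop_m - c.
Definition hop_H (x : 'cV[R]_n) : 'cV[R]_n :=
  hop_m *: x - Lam *m x + T *m (\col_i g i (x i 0)).
Definition hop_B : 'M[R]_n := hop_m%:M + (- Lam + T *m diagv G).

Lemma hopfieldE u x : hopfield Lam T g u x = hop_H x - hop_m *: x + u.
Proof.
rewrite /hopfield /hop_H mulNmx; congr (_ + u).
by rewrite addrAC [_ *: x - _]addrC addrK.
Qed.

(** The summand [c] of [hop_m] cancels, leaving the sum of the |Lambda_ii|. The same sum dominates
    every diagonal entry, which keeps m - Lambda non-negative. *)
Lemma hop_k_ge0 : 0 <= hop_k.
Proof. by rewrite /hop_k /hop_m addrC addKr sumr_ge0. Qed.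

Lemma hop_m_gt0 : 0 < hop_m.
Proof. by rewrite /hop_m ltr_wpDr ?perron_rate_gt0// sumr_ge0. Qed.

Lemma Lam_mulE (x : 'cV[R]_n) i : (Lam *m x) i 0 = Lam i i * x i 0.
Proof.
rewrite mxE (bigD1 i)//= big1 ?addr0// => j ji.
by have /is_diag_mxP -> := Lam_diag; rewrite ?mul0r// eq_sym.
Qed.

Lemma Lam_le_hop_m i : Lam i i <= hop_m.
Proof.
rewrite /hop_m (bigD1 i)//= addrCA (le_trans (ler_norm _))// lerDl.
by rewrite addr_ge0 ?(ltW perron_rate_gt0)// sumr_ge0.
Qed.

Lemma hop_BE (x : 'cV[R]_n) i : (hop_B *m x) i 0 =
  (hop_m - Lam i i) * x i 0 + \sum_j T i j * (G j 0 * x j 0).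
Proof.
rewrite /hop_B mulmxDl mul_scalar_mx mulmxDl mulNmx addrA cVD cVB cVZ Lam_mulE.
rewrite mulrBl; congr (_ + _); rewrite -mulmxA mxE.
by apply: eq_bigr => j _; rewrite diagv_mulE.
Qed.

Lemma hop_HE (x : 'cV[R]_n) i : hop_H x i 0 =
  (hop_m - Lam i i) * x i 0 + \sum_j T i j * g j (x j 0).
Proof.
rewrite /hop_H cVD cVB cVZ Lam_mulE mulrBl; congr (_ + _); rewrite mxE.
by apply: eq_bigr => j _; rewrite mxE.
Qed.

Lemma hop_B_ge0 i j : 0 <= hop_B i j.
Proof.
have -> : hop_B i j = (hop_B *m delta_mx j 0 : 'cV_n) i 0 by rewrite -colE [RHS]mxE.
rewrite hop_BE addr_ge0//.
  by rewrite mulr_ge0 ?subr_ge0 ?Lam_le_hop_m// mxE.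
apply: sumr_ge0 => l _; rewrite !mulr_ge0// ?(ltW (G_gt0 _))//.
by rewrite mxE.
Qed.

Lemma hop_vB j : \sum_i v i 0 * hop_B i j = hop_k * v j 0.
Proof.
have [_ _ vM] := v_perron.
have : (v^T *m hop_B) 0 j = (hop_k *: v^T) 0 j.
  rewrite /hop_B mulmxDr vM mul_mx_scalar -scalerDl.
  by rewrite /hop_k.
move=> vB; transitivity ((v^T *m hop_B) 0 j); last by rewrite vB !mxE.
by rewrite [RHS]mxE; apply: eq_bigr => i _; rewrite [v^T 0 i]mxE.
Qed.

Lemma hop_Bw i : \sum_j hop_B i j * w j 0 = hop_k * w i 0.
Proof.
have [_ _ Mw] := w_perron.
have : (hop_B *m w) i 0 = (hop_k *: w) i 0.
  by rewrite /hop_B mulmxDl Mw mul_scalar_mx -scalerDl.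
by rewrite [LHS]mxE cVZ.
Qed.

Lemma hop_H_norm x y i :
  `|(hop_H x - hop_H y) i 0| <= (hop_B *m (\col_j `|(x - y) j 0|)) i 0.
Proof.
rewrite hop_BE cVB !hop_HE.
rewrite opprD addrACA -mulrBr -sumrB; apply: le_trans (ler_normD _ _) _.
apply: lerD.
  by rewrite normrM !mxE ger0_norm// subr_ge0 Lam_le_hop_m.
apply: le_trans (ler_norm_sum _ _ _) _; apply: ler_sum => j _.
rewrite -mulrBr normrM ger0_norm// ler_wpM2l// !mxE.
exact: (sector_norm (g_sector j)).
Qed.

(** One-sided counterpart of [hop_H_norm]. For x <= y the right side is 0, so it contains the fact
    that [hop_H] preserves order. *)
Lemma hop_H_max0 x y i : (hop_H x - hop_H y) i 0 <=
  (hop_B *m (\col_j Num.max ((x - y) j 0) 0)) i 0.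
Proof.
rewrite hop_BE cVB !hop_HE.
rewrite opprD addrACA -mulrBr -sumrB; apply: lerD.
  by rewrite !mxE ler_wpM2l ?subr_ge0 ?Lam_le_hop_m// le_max lexx.
apply: ler_sum => j _; rewrite -mulrBr ler_wpM2l// !mxE.
exact: (sector_max0 (ltW (G_gt0 j)) (g_sector j)).
Qed.

(** Pairing with the left Perron vector turns the entrywise bound [hop_H_max0] into a scalar one,
    since v^T B = k v^T. It supplies the hypothesis of [decay_system_monotone]. *)
Lemma hop_H_lin_max0 (a b : 'cV[R]_n) :
  \sum_i v i 0 * Num.max ((hop_H a - hop_H b) i 0) 0 <=
  hop_k * \sum_i v i 0 * Num.max ((a - b) i 0) 0.
Proof.
have [_ v0 _] := v_perron.
apply: (@le_trans _ _ (\sum_i v i 0 *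
    (hop_B *m (\col_j Num.max ((a - b) j 0) 0)) i 0)).
  apply: ler_sum => i _; rewrite ler_wpM2l ?(ltW (v0 _))// ge_max hop_H_max0/=.
  rewrite mxE sumr_ge0// => j _.
  by rewrite mulr_ge0 ?hop_B_ge0// !mxE le_max lexx orbT.
rewrite mulr_sumr.
under eq_bigr do rewrite [(_ *m _) _ _]mxE mulr_sumr.
rewrite exchange_big/=; apply: ler_sum => j _.
under eq_bigr do rewrite mulrA.
by rewrite -mulr_suml hop_vB !mxE mulrA.
Qed.

(** The constant is crude and unrelated to the rate: it serves continuity and Picard iteration,
    which work in the sup norm and accept any constant. *)
Lemma hop_H_lipschitz : exists2 L, 0 < L &
  forall x y, `|hop_H x - hop_H y| <= L * `|x - y|.
Proof.
have B0 : 0 <= \sum_i \sum_j hop_B i j.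
  by apply: sumr_ge0 => i _; apply: sumr_ge0 => j _; exact: hop_B_ge0.
exists (1 + \sum_i \sum_j hop_B i j) => [|x y]; first by rewrite ltr_pwDl.
apply: cV_norm_le => [|i]; first by rewrite mulr_ge0// addr_ge0.
apply: le_trans (hop_H_norm _ _ _) _; rewrite mxE.
apply: (@le_trans _ _ ((\sum_j hop_B i j) * `|x - y|)).
  rewrite mulr_suml; apply: ler_sum => j _.
  by rewrite ler_wpM2l ?hop_B_ge0// [leLHS]mxE le_cV_norm.
rewrite ler_wpM2r// [in leRHS](bigD1 i)//= addrCA lerDl addr_ge0//.
by apply: sumr_ge0 => l _; apply: sumr_ge0 => j _; exact: hop_B_ge0.
Qed.

Lemma hop_H_continuous : continuous hop_H.
Proof. by have [L L0 HL] := hop_H_lipschitz; exact: lipschitz_cV_continuous HL. Qed.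

Lemma hop_existence (u : R -> 'cV[R]_n) t0 x0 :
  (forall t, t0 <= t -> forall i,
    (@lebesgue_measure R).-integrable `[t0, t] (EFin \o (fun s => u s i 0))) ->
  exists x, x t0 = x0 /\ solution (decay_system hop_H hop_m u) t0 x.
Proof.
have [L L0 HL] := hop_H_lipschitz => ui.
apply: (@picard_existence _ _ (fun x => hop_H x - hop_m *: x) (L + hop_m)) => //.
  by rewrite addr_gt0// hop_m_gt0.
move=> x y.
have -> : hop_H x - hop_m *: x - (hop_H y - hop_m *: y) =
    (hop_H x - hop_H y) - hop_m *: (x - y).
  by rewrite scalerBr !opprD !opprK addrACA.
apply: le_trans (ler_normB _ _) _; rewrite mulrDl lerD//.
by rewrite normrZ gtr0_norm ?hop_m_gt0.
Qed.

Lemma hop_equilibrium (u : 'cV[R]_n) : exists x, hop_H x - hop_m *: x + u = 0.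
Proof.
have [_ w0 _] := w_perron; have m0 := hop_m_gt0; have k0 := hop_k_ge0.
(* In the coordinates a_j = x_j / w_j the weighted maximum norm becomes the sup norm of the matrix
   type, and B w = k w gives the ratio k / m = 1 - c / m. *)
pose Phi (a : 'cV[R]_n) : 'cV[R]_n :=
  \col_i ((hop_H (\col_j (w j 0 * a j 0)) + u) i 0 / (hop_m * w i 0)).
have q0 : 0 <= hop_k / hop_m by rewrite divr_ge0// ltW.
have Phi_contract a b : `|Phi a - Phi b| <= hop_k / hop_m * `|a - b|.
  apply: cV_norm_le => [|i]; first by rewrite mulr_ge0.
  rewrite cVB [Phi a i 0]mxE [Phi b i 0]mxE -mulrBl !(cVD (hop_H _) u) opprD.
  rewrite addrACA subrr addr0.
  rewrite normrM [X in _ * X]ger0_norm; last first.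
    by rewrite invr_ge0 mulr_ge0 ?(ltW m0) ?(ltW (w0 _)).
  rewrite ler_pdivrMr ?mulr_gt0//.
  rewrite -cVB; apply: le_trans (hop_H_norm _ _ _) _; rewrite mxE.
  rewrite [leRHS](_ : _ = (\sum_j hop_B i j * w j 0) * `|a - b|); last first.
    by rewrite hop_Bw; field; rewrite gt_eqF.
  rewrite mulr_suml; apply: ler_sum => j _; rewrite -mulrA.
  rewrite ler_wpM2l ?hop_B_ge0// mxE cVB !mxE -mulrBr normrM.
  rewrite ger0_norm ?(ltW (w0 _))// ler_wpM2l ?(ltW (w0 _))//.
  by rewrite -cVB le_cV_norm.
(* The complete and normed structures exist on matrices, their join does not. *)
pose cV_complete : completeNormedModType R := HB.pack 'cV[R]_n
  (Uniform_isComplete.Build 'cV[R]_n (@cauchy_cvg 'cV[R]_n)).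
have [a _ aE] : exists2 a, [set: 'cV[R]_n] a & a = Phi a.
  apply: (@banach_fixed_point R cV_complete setT
    [fun of totalfun (Phi : cV_complete -> cV_complete)]); last 2 first.
  - exact: closedT.
  - by exists 0.
  exists (NngNum q0); split=> /=.
    by rewrite ltr_pdivrMr// mul1r /hop_k gtrBl perron_rate_gt0.
  by move=> [a b] _; exact: Phi_contract.
exists (\col_j (w j 0 * a j 0)).
have -> : hop_m *: (\col_j (w j 0 * a j 0)) = hop_H (\col_j (w j 0 * a j 0)) + u.
  apply/colP => i; rewrite cVZ mxE {1}aE mxE.
  by field; rewrite !gt_eqF.
by rewrite opprD addrA subrr sub0r addNr.
Qed.

Context (p q : \bar R) (eta : 'cV[R]_n).
Hypothesis p_ge1 : (1 <= p)%E.
Hypothesis q_ge1 : (1 <= q)%E.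
Hypothesis pq_conj : (p^-1 + q^-1 = 1)%E.
Hypothesis eta_def : forall i,
  eta i 0 = v i 0 `^ fine (p^-1)%E / w i 0 `^ fine (q^-1)%E.

Notation N := (wnorm p (diagv eta)).

Lemma hop_eta_gt0 i : 0 < eta i 0.
Proof.
have [_ v0 _] := v_perron; have [_ w0 _] := w_perron.
exact: schur_eta_gt0 eta_def i.
Qed.

Lemma hop_schur (z : 'cV[R]_n) : vle 0 z -> N (hop_B *m z) <= hop_k * N z.
Proof.
have [_ v0 _] := v_perron; have [_ w0 _] := w_perron => z0.
have inv_fin (r : \bar R) : (1 <= r)%E -> (r^-1 \is a fin_num)%E.
  case: r => [r| |] //.
  by rewrite lee_fin => r1; rewrite inver gt_eqF// (lt_le_trans _ r1).
(* The inverses are finite, with 1 / +oo = 0, so conjugacy becomes the equation between real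
   exponents that the Schur test requires. *)
have ab : fine p^-1%E + fine q^-1%E = 1.
  have := congr1 fine pq_conj; rewrite fineD//; exact: inv_fin.
move: p_ge1 ab eta_def; case: p => [r| |] //; rewrite ?lee_fin => r1 ab ed.
  have rE : fine (r%:E^-1)%E = r^-1 by rewrite inver gt_eqF// (lt_le_trans _ r1).
  exact: (schur_test_fin hop_B_ge0 v0 w0 hop_k_ge0 hop_vB hop_Bw ab ed).
exact: (schur_test_infty hop_B_ge0 w0 hop_k_ge0 hop_Bw ab ed).
Qed.

Lemma hop_dual : dual_norm N. Proof. exact: dual_norm_wnorm. Qed.

Lemma hop_H_contract x y : N (hop_H x - hop_H y) <= hop_k * N (x - y).
Proof.
apply: (@le_trans _ _ (N (hop_B *m (\col_j `|(x - y) j 0|)))).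
  apply: (dual_norm_le hop_dual) => i.
  by apply: le_trans (hop_H_norm _ _ _) (ler_norm _).
apply: (@le_trans _ _ (hop_k * N (\col_j `|(x - y) j 0|))).
  by apply: hop_schur => i; rewrite !mxE.
rewrite ler_wpM2l ?hop_k_ge0//; apply: (dual_norm_le hop_dual) => i.
by rewrite mxE normr_id.
Qed.

Lemma hop_definite x : N x = 0 -> x = 0.
Proof. by apply: wnorm_eq0 => // i; rewrite gt_eqF// hop_eta_gt0. Qed.

Lemma hop_incremental (u u' : R -> 'cV[R]_n) t0 x y t : t0 <= t ->
  (forall i, (@lebesgue_measure R).-integrable `[t0, t]
    (EFin \o (fun s => u s i 0))) ->
  (forall i, (@lebesgue_measure R).-integrable `[t0, t]
    (EFin \o (fun s => u' s i 0))) ->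
  solution (decay_system hop_H hop_m u) t0 x ->
  solution (decay_system hop_H hop_m u') t0 y ->
  N (x t - y t) <= voc (- c) t0 (N (x t0 - y t0)) (fun s => N (u s - u' s)) t.
Proof.
move=> t0t ui ui' xs ys.
have -> : - c = hop_k - hop_m by rewrite /hop_k addrAC subrr add0r.
apply: (decay_system_incremental hop_H_continuous hop_dual _ hop_k_ge0) => //.
  exact: measurable_norm_wnorm.
exact: hop_H_contract.
Qed.

Lemma hop_contraction (u : R -> 'cV[R]_n) t0 x y t : t0 <= t ->
  (forall i, (@lebesgue_measure R).-integrable `[t0, t]
    (EFin \o (fun s => u s i 0))) ->
  solution (decay_system hop_H hop_m u) t0 x ->
  solution (decay_system hop_H hop_m u) t0 y ->
  N (x t - y t) <= expR (- c * (t - t0)) * N (x t0 - y t0).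
Proof.
move=> t0t ui xs ys; apply: le_trans (hop_incremental t0t ui ui xs ys) _.
rewrite /voc; under eq_Rintegral do rewrite subrr (dual_norm0 hop_dual) mulr0.
by rewrite Rintegral_cst// mul0r addr0.
Qed.

Section Input.
Context (u : R -> 'cV[R]_n).
Hypothesis u_int : loc_integrable u.

Let ui t0 t i : 0 <= t0 -> t0 <= t ->
  (@lebesgue_measure R).-integrable `[t0, t] (EFin \o (fun s => u s i 0)).
Proof.
by move=> t00 t0t; apply: integrable_itvS (u_int (le_trans t00 t0t) i) _ _.
Qed.

Lemma hop_flow : exists phi, is_flow (decay_system hop_H hop_m u) phi.
Proof.
have ex (z : R * 'cV[R]_n) : exists x : R -> 'cV[R]_n, 0 <= z.1 ->
    x z.1 = z.2 /\ solution (decay_system hop_H hop_m u) z.1 x.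
  have [z0|z0] := leP 0 z.1; last by exists (fun=> 0).
  have [t t0t i|x xE] := @hop_existence u z.1 z.2; first exact: ui.
  by exists x.
have [X XE] := choice ex; exists (fun t t0 x0 => X (t0, x0) t) => t0 x0 t00.
have [/= X0 Xs] := XE (t0, x0) t00; split=> // x xs xt0 t t0t.
(* Uniqueness: contraction keeps two solutions with the same initial value at distance 0, and [N] is
   definite. *)
apply/eqP; rewrite -subr_eq0; apply/eqP; apply: hop_definite; apply/eqP.
rewrite eq_le (dual_norm_ge0 hop_dual) andbT.
apply: le_trans (hop_contraction t0t (fun i => ui i t00 t0t) xs Xs) _.
by rewrite xt0 X0 subrr (dual_norm0 hop_dual) mulr0.
Qed.

Lemma hop_monotone : monotone_system (decay_system hop_H hop_m u).
Proof.
have [_ v0 _] := v_perron; have [phi phiE] := hop_flow.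
exists phi => // t0 t x0 y0 t00 t0t xy.
have [px sx _] := phiE t0 x0 t00; have [py sy _] := phiE t0 y0 t00.
apply: (decay_system_monotone hop_H_continuous v0 hop_k_ge0 hop_H_lin_max0
  t0t (fun i => ui i t00 t0t) sx sy).
by rewrite px py.
Qed.

Lemma hop_contracting :
  contracting_system (decay_system hop_H hop_m u) N c.
Proof.
split; first exact: perron_rate_gt0; have [phi phiE] := hop_flow.
exists phi => // t0 t x y t00 t0t.
have [px sx _] := phiE t0 x t00; have [py sy _] := phiE t0 y t00.
have := hop_contraction t0t (fun i => ui i t00 t0t) sx sy.
by rewrite px py.
Qed.
End Input.

Section ConstantInput.
Context (u : 'cV[R]_n).

Definition hop_F (x : 'cV[R]_n) := hop_H x - hop_m *: x + u.

Let ui t0 t i : (@lebesgue_measure R).-integrable `[t0, t]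
  (EFin \o (fun s : R => u i 0)).
Proof. by apply: continuous_itv_integrable => t'; exact: cvg_cst. Qed.

Lemma hop_FB x y : hop_F x - hop_F y = (hop_H x - hop_H y) - hop_m *: (x - y).
Proof.
rewrite /hop_F; move: (hop_H x) (hop_H y) => a b.
by rewrite scalerBr !opprD !opprK addrACA subrr addr0 addrACA.
Qed.

Lemma hop_F_continuous : continuous hop_F.
Proof.
have [L L0 HL] := hop_H_lipschitz.
apply: (@lipschitz_cV_continuous _ _ _ (L + hop_m)).
  by rewrite addr_gt0// hop_m_gt0.
move=> x y; rewrite hop_FB; apply: le_trans (ler_normB _ _) _; rewrite mulrDl lerD//.
by rewrite normrZ gtr0_norm ?hop_m_gt0.
Qed.

(** Write m(x - y) as (H(x) - H(y)) + (F(y) - F(x)); the first term costs at most k N(x - y), and m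
    - k = c. This gives uniqueness of the zero of the field and lets N(F) inherit positivity and
    growth from the distance to the equilibrium. *)
Lemma hop_F_expand x y : c * N (x - y) <= N (hop_F x - hop_F y).
Proof.
have E : hop_m *: (x - y) = (hop_H x - hop_H y) + (hop_F y - hop_F x).
  by rewrite -[hop_F y - hop_F x]opprB hop_FB opprB [RHS]addrC subrK.
have := dual_norm_triangle hop_dual (hop_H x - hop_H y) (hop_F y - hop_F x).
rewrite -E (dual_normZ hop_dual) gtr0_norm ?hop_m_gt0//.
rewrite (dual_norm_distC hop_dual (hop_F y)) => H.
have := le_trans H (lerD (hop_H_contract x y) (lexx _)).
by rewrite /hop_k; lra.
Qed.

Lemma hop_F_contraction s t x y : s <= t ->
  solution (fun=> hop_F) s x -> solution (fun=> hop_F) s y ->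
  N (x t - y t) <= expR (- c * (t - s)) * N (x s - y s).
Proof. by move=> st; apply: hop_contraction. Qed.

(** With it, contraction between two trajectories reads as decay towards the equilibrium. *)
Lemma hop_F_constant_solution xs s : hop_F xs = 0 ->
  solution (fun=> hop_F) s (fun=> xs).
Proof.
move=> Fxs t st i; rewrite Fxs; split.
  by apply: continuous_itv_integrable => r; exact: cvg_cst.
by under eq_Rintegral do rewrite mxE; rewrite Rintegral_cst// mul0r addr0.
Qed.

Lemma hop_F_zero : exists xs, forall x, hop_F x = 0 <-> x = xs.
Proof.
have [xs xsE] : exists xs, hop_F xs = 0 by exact: hop_equilibrium.
exists xs => x; split=> [Fx|->//].
apply/eqP; rewrite -subr_eq0; apply/eqP/hop_definite/eqP.
rewrite eq_le (dual_norm_ge0 hop_dual) andbT.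
have := hop_F_expand x xs; rewrite Fx xsE subrr (dual_norm0 hop_dual).
by rewrite pmulr_rle0// perron_rate_gt0.
Qed.

Context (xs : 'cV[R]_n).
Hypothesis Fxs : hop_F xs = 0.

Lemma hop_decay s t x : s <= t -> solution (fun=> hop_F) s x ->
  N (x t - xs) <= expR (- c * (t - s)) * N (x s - xs).
Proof.
move=> st sx.
exact: (hop_F_contraction st sx (@hop_F_constant_solution xs s Fxs)).

Qed.

Lemma hop_globally_exp_stable : globally_exp_stable hop_F xs.
Proof.
have [C C0 HC] := norm_le_dual_norm hop_dual hop_definite.
have N1 := dual_norm_ge0 hop_dual (const_mx 1).
(* [C] and [N (const_mx 1)] compare [N] with the sup norm in the two directions; adding 1 keeps the
   product positive when [n = 0]. *)
exists (C * (N (const_mx 1) + 1)), c; split.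
- by rewrite mulr_gt0// ltr_wpDl.
- exact: perron_rate_gt0.
move=> t0 x t00 sx t t0t; apply: le_trans (HC _) _.
rewrite -!mulrA ler_wpM2l ?(ltW C0)//; apply: le_trans (hop_decay t0t sx) _.
rewrite mulrCA ler_wpM2l ?expR_ge0//.
apply: le_trans (dual_norm_le_norm hop_dual _) _.
by rewrite ler_wpM2r// lerDl.
Qed.

Lemma hop_lyapunov_dist : lyapunov_function hop_F xs (fun x => N (x - xs)).
Proof.
have [C C0 HC] := norm_le_dual_norm hop_dual hop_definite.
split.
- apply: (dual_norm_comp_continuous hop_dual).
  by apply: (@continuous_subr _ _ id) => y; exact: cvg_id.
- by rewrite subrr (dual_norm0 hop_dual).
- move=> x xxs; apply: (dual_norm_gt0 hop_dual hop_definite).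
  by rewrite subr_eq0.
- move=> M; exists (C * M + `|xs|) => x xM; rewrite -(ltr_pM2l C0).
  apply: lt_le_trans (HC _); rewrite -(ltrD2r `|xs|).
  by apply: lt_le_trans xM _; rewrite (le_trans _ (ler_normD _ _))// subrK.
exists c; first exact: perron_rate_gt0.
move=> t0 x t00 sx s t t0s st; apply: hop_decay => //.
exact: solution_restart sx.
Qed.

Lemma hop_lyapunov_field : lyapunov_function hop_F xs (fun x => N (hop_F x)).
Proof.
have [C C0 HC] := norm_le_dual_norm hop_dual hop_definite.
have c0 := perron_rate_gt0.
have expand x : c * N (x - xs) <= N (hop_F x).
  by have := hop_F_expand x xs; rewrite Fxs subr0.
split.
- exact: (dual_norm_comp_continuous hop_dual hop_F_continuous).
- by rewrite Fxs (dual_norm0 hop_dual).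
- move=> x xxs; apply: lt_le_trans (expand x); rewrite mulr_gt0//.
  by apply: (dual_norm_gt0 hop_dual hop_definite); rewrite subr_eq0.
- move=> M; have [_ _ _ /(_ (M / c))[r Hr] _] := hop_lyapunov_dist.
  exists r => x /Hr; rewrite ltr_pdivrMr// mulrC => /lt_le_trans; exact.
exists c => // t0 x t00 sx s t t0s st.
have sxs := solution_restart t0s sx.
apply: (contraction_vector_field_decay hop_F_continuous hop_dual) => //.
  exact: measurable_norm_wnorm.
by move=> y z; exact: hop_F_contraction.
Qed.
End ConstantInput.
End Hopfield.

Theorem propositionV1 (R : realType) (n : nat)
  (Lam T : 'M[R]_n) (I : R -> 'cV[R]_n) (g : 'I_n -> R -> R)
  (G : 'cV[R]_n) (c : R) (v w : 'cV[R]_n)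
  (Lam_diag : is_diag_mx Lam) (Lam_pos : posdef Lam)
  (T_irr : irreducible_mx T) (T_ge0 : forall i j, 0 <= T i j)
  (I_int : loc_integrable I) (I_ge0 : forall t, 0 <= t -> vle 0 (I t))
  (g_lip : forall i, lipschitz (g i))
  (g_mono : forall i, {homo g i : a b / a <= b})
  (g_0 : forall i, g i 0 = 0)
  (G_gt0 : forall i, 0 < G i 0)
  (g_sector : forall i a b, a != b ->
    0 <= (g i a - g i b) / (a - b) <= G i 0)
  (M_hurwitz : hurwitz (- Lam + T *m diagv G))
  (v_perron : left_perron_pair (- Lam + T *m diagv G) (- c) v)
  (w_perron : right_perron_pair (- Lam + T *m diagv G) (- c) w)
  (p q : \bar R) (p_ge1 : (1 <= p)%E) (q_ge1 : (1 <= q)%E)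
  (pq_conj : (p^-1 + q^-1 = 1)%E)
  (eta : 'cV[R]_n)
  (eta_def : forall i,
    eta i 0 = v i 0 `^ fine (p^-1)%E / w i 0 `^ fine (q^-1)%E) :
  [/\ (* (i) *)
      monotone_system (fun t => hopfield Lam T g (I t)) /\
      contracting_system (fun t => hopfield Lam T g (I t))
        (wnorm p (diagv eta)) c,
      (* (ii) *)
      forall Istar : 'cV[R]_n, (forall t, 0 <= t -> I t = Istar) ->
        exists xs : 'cV[R]_n,
          [/\ forall x, hopfield Lam T g Istar x = 0 <-> x = xs,
              globally_exp_stable (hopfield Lam T g Istar) xs,
              lyapunov_function (hopfield Lam T g Istar) xs
                (fun x => wnorm p (diagv eta) (x - xs)) &
              lyapunov_function (hopfield Lam T g Istar) xs
                (fun x => wnorm p (diagv eta) (hopfield Lam T g Istar x))] &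
      (* (iii) *)
      forall (J : R -> 'cV[R]_n) (xI xJ : R -> 'cV[R]_n),
        loc_integrable J -> (forall t, 0 <= t -> vle 0 (J t)) ->
        solution (fun t => hopfield Lam T g (I t)) 0 xI ->
        solution (fun t => hopfield Lam T g (J t)) 0 xJ ->
        forall t, 0 <= t ->
          wnorm p (diagv eta) (xI t - xJ t) <=
            expR (- c * t) * wnorm p (diagv eta) (xI 0 - xJ 0) +
            \int[@lebesgue_measure R]_(s in `[0, t])
              (expR (- c * (t - s)) * wnorm p (diagv eta) (I s - J s))].
Proof.
have fieldE (u : R -> 'cV[R]_n) : (fun t => hopfield Lam T g (u t)) =
    decay_system (hop_H Lam T g c) (hop_m Lam c) u.
  by apply/funext => t; apply/funext => x; rewrite (hopfieldE Lam T g c).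
split.
- rewrite fieldE; split.
    exact: (hop_monotone Lam_diag T_ge0 G_gt0 g_sector M_hurwitz v_perron
      w_perron p_ge1 q_ge1 pq_conj eta_def I_int).
  exact: (hop_contracting Lam_diag T_ge0 G_gt0 g_sector M_hurwitz v_perron
    w_perron p_ge1 q_ge1 pq_conj eta_def I_int).
- move=> u _; have -> : hopfield Lam T g u = hop_F Lam T g c u.
    by apply/funext => x; rewrite (hopfieldE Lam T g c).
  have [xs xsE] := hop_F_zero Lam_diag T_ge0 G_gt0 g_sector M_hurwitz v_perron
    w_perron p_ge1 q_ge1 pq_conj eta_def u.
  have Fxs : hop_F Lam T g c u xs = 0 by apply/xsE.
  exists xs; split=> //.
  + exact: (hop_globally_exp_stable Lam_diag T_ge0 G_gt0 g_sector M_hurwitz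
      v_perron w_perron p_ge1 q_ge1 pq_conj eta_def Fxs).
  + exact: (hop_lyapunov_dist Lam_diag T_ge0 G_gt0 g_sector M_hurwitz
      v_perron w_perron p_ge1 q_ge1 pq_conj eta_def Fxs).
  + exact: (hop_lyapunov_field Lam_diag T_ge0 G_gt0 g_sector M_hurwitz
      v_perron w_perron p_ge1 q_ge1 pq_conj eta_def Fxs).
- move=> J xI xJ J_int _; rewrite !fieldE => sI sJ t t0.
  have := hop_incremental Lam_diag T_ge0 G_gt0 g_sector M_hurwitz v_perron
    w_perron p_ge1 q_ge1 pq_conj eta_def t0 (I_int t t0) (J_int t t0) sI sJ.
  by rewrite /voc subr0.
Qed.
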